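(* Let $(F,E,L)$ be a $\sigma$-admissible triple, $\Phi\in\mathrm{GL}_r(E)$, $\Psi\in\mathrm{GL}_r(L)$ with $\sigma(\Psi)=\Phi\Psi$, and $\Sigma,\Lambda,\Lambda_l,\Gamma$ as in the context. Let $F'/F$ be an algebraic field extension such that $\Gamma(F')$ is Zariski dense in $\Gamma_{F'}$, and assume that $F'=F$ or that $\Lambda_l/F$ is a regular extension for every $l$. Then $(\Lambda')^{\Gamma(F')}=E'$ and $\Lambda\cap(\Lambda')^{\Gamma(F')}=E$.
   Context: A $\sigma$-admissible triple $(F,E,L)$ consists of a positive integer $d$, rings $F\subset E\subset L$ with $F,E$ fields and $L=\prod_{l\in\mathbb{Z}/d}L_l$ a finite product of fields, and a ring endomorphism $\sigma:L\to L$ with $\sigma(E)\subset E$, $\sigma(L_l)\subset L_{l+1}$, $F=E^\sigma=L^\sigma$, and $L$ separable over $E$. Write $\Psi_{ij}=(\Psi_{ijl})_l$ and $\Psi_l=(\Psi_{ijl})$. $\Sigma:=E[\Psi,\det\Psi^{-1}]\subset L$, $\Sigma_l:=E[\Psi_l,\det\Psi_l^{-1}]\subset L_l$, $\Lambda$ the total ring of fractions of $\Sigma$, $\Lambda_l=\mathrm{Frac}(\Sigma_l)$; a field extension is regular if it is separable and the base is algebraically closed in it. With $X=(X_{ij})$ indeterminates and $\Delta=\det X$, $\Gamma:=\mathrm{Spec}\,F[X,\Delta^{-1}]/\mathfrak q$, where $\mathfrak q$ is the kernel of $F[X,\Delta^{-1}]\to L\otimes_EL$, $X\mapsto(\Psi_{ij}\otimes1)^{-1}(1\otimes\Psi_{ij})$;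 it is a closed subgroup scheme of $\mathrm{GL}_{r/F}$. For an $F$-algebra $S$ write $S':=F'\otimes_FS$. An element $\gamma\in\Gamma(F')$ acts on $\Sigma'=E'[\Psi,\det\Psi^{-1}]$ by $h(\Psi)\mapsto h(\Psi\gamma)$, and this action extends to $\Lambda'$; $(\Lambda')^{\Gamma(F')}$ denotes the fixed elements. *)

(* Defs.v *)
From HB Require Import structures.
From mathcomp Require Import all_boot all_order all_algebra generic_quotient.
From mathcomp Require Import boolp classical_sets.
From mathcomp Require Import mpoly.

Set Implicit Arguments.
Unset Strict Implicit.
Unset Printing Implicit Defensive.

Import GRing.Theory.
Local Open Scope ring_scope.
Local Open Scope quotient_scope.

Section FormalSums.
Variables (K : fieldType) (A B : comNzRingType).
Variables (f : {rmorphism K -> A}) (g : {rmorphism K -> B}).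

(* A list [:: (a1, b1); ...; (an, bn)] stands for the formal sum of the
   symbols ai (x) bi; [tens_rel] is the congruence on the free commutative
   monoid on A * B that defines the tensor product over K. *)
Inductive tens_rel : seq (A * B) -> seq (A * B) -> Prop :=
| tens_refl s : tens_rel s s
| tens_sym s t : tens_rel s t -> tens_rel t s
| tens_trans s t u : tens_rel s t -> tens_rel t u -> tens_rel s u
| tens_cat s s' t t' :
    tens_rel s s' -> tens_rel t t' -> tens_rel (s ++ t) (s' ++ t')
| tens_comm s t : tens_rel (s ++ t) (t ++ s)
| tens_zero : tens_rel [:: (0, 0)] [::]
| tens_Dl a a' b : tens_rel [:: (a + a', b)] [:: (a, b); (a', b)]
| tens_Dr a b b' : tens_rel [:: (a, b + b')] [:: (a, b); (a, b')]
| tens_Z k a b : tens_rel [:: (f k * a, b)] [:: (a, g k * b)].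

Definition tens_eq : rel (seq (A * B)) := fun s t => `[< tens_rel s t >].

Lemma tens_eq_equiv : equiv_class_of tens_eq.
Proof.
split=> [s|s t|t s u].
- by apply/asboolP; apply: tens_refl.
- by apply/asboolP/asboolP; apply: tens_sym.
- by move=> /asboolP h1 /asboolP h2; apply/asboolP; apply: tens_trans h1 h2.
Qed.
Canonical tens_equiv := EquivRelPack tens_eq_equiv.
Canonical tens_encModRel := defaultEncModRel tens_eq.

Definition tensor := {eq_quot tens_eq}.
HB.instance Definition _ : EqQuotient (seq (A * B)) tens_eq tensor :=
  EqQuotient.on tensor.
HB.instance Definition _ := Choice.on tensor.

Lemma tensorP s t : \pi_tensor s = \pi_tensor t <-> tens_rel s t.
Proof.
split=> [/eqP|h]; first by rewrite piE => /asboolP.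
by apply/eqP; rewrite piE; apply/asboolP.
Qed.

Lemma tens_repr s : tens_rel (repr (\pi_tensor s)) s.
Proof. by apply/tensorP; rewrite reprK. Qed.

Definition fs_opp (s : seq (A * B)) := [seq (- p.1, p.2) | p <- s].
Definition fs_mul (s t : seq (A * B)) :=
  [seq (p.1 * q.1, p.2 * q.2) | p <- s, q <- t].

Lemma tens_rel0l b : tens_rel [:: (0, b)] [::].
Proof.
apply: tens_trans tens_zero.
by have := tens_Z 0 0 b; rewrite !rmorph0 !mul0r.
Qed.

Lemma fs_opp_compat s t : tens_rel s t -> tens_rel (fs_opp s) (fs_opp t).
Proof.
elim=> {s t}; rewrite /fs_opp /=.
- by move=> s; apply: tens_refl.
- by move=> s t _; apply: tens_sym.
- by move=> s t u _ h1 _; apply: tens_trans.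
- by move=> s s' t t' _ h1 _ h2; rewrite !map_cat; apply: tens_cat.
- by move=> s t; rewrite !map_cat; apply: tens_comm.
- by rewrite oppr0; apply: tens_zero.
- by move=> a a' b; rewrite opprD; apply: tens_Dl.
- by move=> a b b'; apply: tens_Dr.
- by move=> k a b; rewrite -mulrN; apply: tens_Z.
Qed.

Lemma fs_opp_addl s : tens_rel (fs_opp s ++ s) [::].
Proof.
elim: s => [|[a b] s ih] /=; first exact: tens_refl.
rewrite -/(fs_opp s) -[X in tens_rel X _]/([:: (- a, b)] ++ (fs_opp s ++ [:: (a, b)] ++ s)).
apply: (@tens_trans _ ([:: (- a, b)] ++ ([:: (a, b)] ++ s) ++ fs_opp s)).
  by apply: tens_cat; [apply: tens_refl | apply: tens_comm].
rewrite !catA -catA.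
apply: (@tens_trans _ ([::] ++ [::])); last exact: tens_refl.
apply: tens_cat.
  apply: tens_trans (tens_rel0l b).
  by apply: tens_sym; have := tens_Dl (- a) a b; rewrite addNr.
by apply: tens_trans ih; apply: tens_comm.
Qed.

Lemma fs_mulDl s s' t : fs_mul (s ++ s') t = fs_mul s t ++ fs_mul s' t.
Proof. exact: allpairs_cat. Qed.

Lemma tens_perm s t : perm_eq s t -> tens_rel s t.
Proof.
elim: s t => [|x s ih] t.
  by rewrite perm_sym => /perm_nilP->; apply: tens_refl.
move=> h; have xt : x \in t by rewrite -(perm_mem h) mem_head.
case/splitPr: xt h => t1 t2 h.
have {}h : perm_eq s (t1 ++ t2).
  by rewrite -(perm_cons x) (perm_trans h) // perm_catC /= perm_cons perm_catC.
apply: (@tens_trans _ ([:: x] ++ (t1 ++ t2))).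
  by rewrite -cat1s; apply: tens_cat; [apply: tens_refl | apply: ih].
rewrite -[x :: t2]cat1s !catA.
by apply: tens_cat; [apply: tens_comm | apply: tens_refl].
Qed.

Lemma perm_fs_mulDr s t t' : perm_eq (fs_mul s (t ++ t')) (fs_mul s t ++ fs_mul s t').
Proof. by rewrite /fs_mul perm_allpairs_catr. Qed.

Lemma perm_fs_mulC s t : perm_eq (fs_mul s t) (fs_mul t s).
Proof.
elim: s => [|p s ih]; first by rewrite /fs_mul allpairs0r.
rewrite -[p :: s]cat1s fs_mulDl perm_sym.
rewrite (perm_trans (perm_fs_mulDr _ _ _)) // perm_cat 1?perm_sym //.
rewrite /fs_mul allpairs1l allpairs1r; apply/permP => P; congr count.
by apply: eq_map => q; rewrite [p.1 * _]mulrC [p.2 * _]mulrC.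
Qed.

Lemma fs_mul_compat1 s t u : tens_rel s t -> tens_rel (fs_mul s u) (fs_mul t u).
Proof.
have mul1E p (v : seq (A * B)) :
    fs_mul [:: p] v = [seq (p.1 * q.1, p.2 * q.2) | q <- v].
  by rewrite /fs_mul /= cats0.
have single p v : (forall q, tens_rel (fs_mul [:: p] [:: q]) (fs_mul v [:: q])) ->
    tens_rel (fs_mul [:: p] u) (fs_mul v u).
  move=> h; elim: u => [|q u ih].
    rewrite mul1E /=; apply: tens_trans (tens_refl [::]) _.
    by apply: tens_perm; elim: v {h} => //.
  rewrite -[q :: u]cat1s; apply: tens_trans (tens_perm (perm_fs_mulDr _ _ _)) _.
  apply: tens_trans (tens_sym (tens_perm (perm_fs_mulDr _ _ _))).
  by apply: tens_cat.
elim=> {s t}.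
- by move=> s; apply: tens_refl.
- by move=> s t _; apply: tens_sym.
- by move=> s t v _ h1 _; apply: tens_trans.
- by move=> s s' t t' _ h1 _ h2; rewrite !fs_mulDl; apply: tens_cat.
- by move=> s t; rewrite !fs_mulDl; apply: tens_comm.
- by apply: single => q; rewrite /fs_mul /= !mul0r; apply: tens_zero.
- move=> a a' b; apply: single => q; rewrite /fs_mul /= mulrDl; exact: tens_Dl.
- move=> a b b'; apply: single => q; rewrite /fs_mul /= mulrDl; exact: tens_Dr.
- move=> k a b; apply: single => q; rewrite /fs_mul /= -!mulrA; exact: tens_Z.
Qed.

Lemma fs_mul_compat s s' t t' : tens_rel s s' -> tens_rel t t' ->
  tens_rel (fs_mul s t) (fs_mul s' t').
Proof.
move=> h1 h2; apply: tens_trans (fs_mul_compat1 _ h1) _.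
apply: tens_trans (tens_perm (perm_fs_mulC _ _)) _.
apply: tens_trans (tens_perm (perm_fs_mulC _ _)).
exact: fs_mul_compat1.
Qed.

Lemma fs_mulA s t u : fs_mul s (fs_mul t u) = fs_mul (fs_mul s t) u.
Proof.
elim: s => [//|p s ih].
rewrite -[p :: s]cat1s !fs_mulDl -ih; congr (_ ++ _).
rewrite /fs_mul /= !cats0 /=.
elim: t {ih} => [//|q t iht] /=; rewrite map_cat iht; congr (_ ++ _).
by rewrite -map_comp; apply: eq_map => v /=; rewrite !mulrA.
Qed.

Definition tens_add (x y : tensor) : tensor := \pi_tensor (repr x ++ repr y).
Definition tens_opp (x : tensor) : tensor := \pi_tensor (fs_opp (repr x)).
Definition tens_mul (x y : tensor) : tensor := \pi_tensor (fs_mul (repr x) (repr y)).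

Lemma tens_addE s t : tens_add (\pi_tensor s) (\pi_tensor t) = \pi_tensor (s ++ t).
Proof. by apply/tensorP/tens_cat; apply: tens_repr. Qed.
Lemma tens_oppE s : tens_opp (\pi_tensor s) = \pi_tensor (fs_opp s).
Proof. by apply/tensorP/fs_opp_compat/tens_repr. Qed.
Lemma tens_mulE s t : tens_mul (\pi_tensor s) (\pi_tensor t) = \pi_tensor (fs_mul s t).
Proof. by apply/tensorP/fs_mul_compat; apply: tens_repr. Qed.

Let pi_repr (x : tensor) : x = \pi_tensor (repr x).
Proof. by rewrite reprK. Qed.

Fact tens_addA : associative tens_add.
Proof.
move=> x y z; rewrite (pi_repr x) (pi_repr y) (pi_repr z).
by rewrite !tens_addE catA.
Qed.
Fact tens_addC : commutative tens_add.
Proof.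
move=> x y; rewrite (pi_repr x) (pi_repr y) !tens_addE.
exact/tensorP/tens_comm.
Qed.
Fact tens_add0 : left_id (\pi_tensor [::]) tens_add.
Proof. by move=> x; rewrite (pi_repr x) tens_addE. Qed.
Fact tens_addN : left_inverse (\pi_tensor [::]) tens_opp tens_add.
Proof.
move=> x; rewrite (pi_repr x) tens_oppE tens_addE.
exact/tensorP/fs_opp_addl.
Qed.
HB.instance Definition _ :=
  GRing.isZmodule.Build tensor tens_addA tens_addC tens_add0 tens_addN.

Fact tens_mulA : associative tens_mul.
Proof.
move=> x y z; rewrite (pi_repr x) (pi_repr y) (pi_repr z).
by rewrite !tens_mulE fs_mulA.
Qed.
Fact tens_mulC : commutative tens_mul.
Proof.
move=> x y; rewrite (pi_repr x) (pi_repr y) !tens_mulE.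
exact/tensorP/tens_perm/perm_fs_mulC.
Qed.
Fact tens_mul1 : left_id (\pi_tensor [:: (1, 1)]) tens_mul.
Proof.
move=> x; rewrite (pi_repr x) tens_mulE /fs_mul /= cats0.
by rewrite (eq_map (g := id)) ?map_id // => -[a b] /=; rewrite !mul1r.
Qed.
Fact tens_mulDl : left_distributive tens_mul +%R.
Proof.
move=> x y z; rewrite (pi_repr x) (pi_repr y) (pi_repr z).
rewrite [_ + _]tens_addE !tens_mulE fs_mulDl.
exact/esym/tens_addE.
Qed.

(* A K-linear form on A with value 1 at 1: it shows that A (x) B <> 0. *)
Lemma exists_linear_form :
  exists phi : A -> K, [/\ phi 1 = 1, {morph phi : x y / x + y} &
                          forall k x, phi (f k * x) = k * phi x].
Proof.
pose P (W : set A) := ~ W 1 /\ (forall k x y, W x -> W y -> W (f k * x + y)).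
have [|W [[W1 Wlin] Wmax]] := @Zorn_bigcup A P.
  move=> F FP Ftot; split.
    by move=> [X FX X1]; case: (FP _ FX) => + _; apply.
  move=> k x y [X FX Xx] [Y FY Yy].
  case: (Ftot _ _ FX FY) => sub.
    by exists Y => //; case: (FP _ FY) => _; apply => //; apply: sub.
  by exists X => //; case: (FP _ FX) => _; apply => //; apply: sub.
have maxE V : P V -> (forall x, W x -> V x) -> forall x, V x -> W x.
  move=> PV WV x Vx; apply: contrapT => nWx.
  apply: (Wmax V) PV; split; first exact: WV.
  by move=> sub; apply: nWx; apply: sub.
have W0 : W 0.
  apply: (maxE (fun x => W x \/ x = 0)); [|by left|by right].
    split; first by move=> [//|/eqP]; rewrite oner_eq0.
    move=> k x y [Wx|->] [Wy|->].
    - by left; apply: Wlin.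
    - left; have := Wlin (k - 1) x x Wx Wx.
      by rewrite rmorphB rmorph1 mulrBl mul1r subrK addr0.
    - by left; rewrite mulr0 add0r.
    - by right; rewrite mulr0 addr0.
have WZ k x : W x -> W (f k * x) by move=> Wx; rewrite -[_ * _]addr0; apply: Wlin.
have WD x y : W x -> W y -> W (x + y).
  by move=> Wx Wy; rewrite -[x]mul1r -(rmorph1 f); apply: Wlin.
have WN x : W x -> W (- x).
  by move=> /(WZ (-1)); rewrite rmorphN1 mulN1r.
have WK k : W (f k) -> k = 0.
  move=> Wk; apply: contrapT => /eqP k0; apply: W1.
  by rewrite -(rmorph1 f) -(mulVf k0) rmorphM; apply: WZ.
have decomp x : exists k, W (x - f k).
  have [Wx|nWx] := pselect (W x); first by exists 0; rewrite rmorph0 subr0.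
  have [[w [k [Ww E]]]|noV] := pselect (exists w k, W w /\ 1 = w + f k * x).
    have k0 : k != 0.
      by apply/eqP => k0; move: E; rewrite k0 rmorph0 mul0r addr0 => E;
        apply: W1; rewrite E.
    exists k^-1; have -> : x - f k^-1 = f (- k^-1) * w.
      have xE : x = f k^-1 * (1 - w).
        by rewrite E addrC addrA addNr add0r mulrA -rmorphM mulVf // rmorph1 mul1r.
      by rewrite {1}xE mulrBr mulr1 addrAC subrr add0r rmorphN mulNr.
    exact: WZ.
  case: nWx; apply: (maxE (fun y => exists w k, W w /\ y = w + f k * x)).
  - split; first by move=> [w [k [Ww E]]]; apply: noV; exists w, k.
    move=> c _ _ [w [k [Ww ->]]] [w' [k' [Ww' ->]]].
    exists (f c * w + w'), (c * k + k'); split; first exact: Wlin.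
    by rewrite rmorphD rmorphM mulrDr mulrDl !mulrA addrACA.
  - by move=> y Wy; exists y, 0; rewrite rmorph0 mul0r addr0.
  - by exists 0, 1; rewrite rmorph1 mul1r add0r.
have [phi phiP] := choice decomp.
have phi_uniq x k : W (x - f k) -> phi x = k.
  move=> h; apply/eqP; rewrite -subr_eq0; apply/eqP/WK.
  have := WD _ _ h (WN _ (phiP x)).
  by rewrite opprB addrC addrA subrK rmorphB.
exists phi; split.
- by apply: phi_uniq; rewrite rmorph1 subrr.
- move=> x y; apply: phi_uniq.
  by rewrite rmorphD opprD addrACA; apply: WD.
- by move=> k x; apply: phi_uniq; rewrite rmorphM -mulrBr; apply: WZ.
Qed.

Fact tens_1_neq0 : (\pi_tensor [:: (1, 1)]) != 0.
Proof.
apply/eqP => /tensorP h.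
have [phi [phi1 phiD phiZ]] := exists_linear_form.
have phi0 : phi 0 = 0 by have := phiZ 0 0; rewrite !mul0r rmorph0 mul0r.
have inv s t : tens_rel s t ->
    \sum_(p <- s) g (phi p.1) * p.2 = \sum_(p <- t) g (phi p.1) * p.2.
  elim=> {s t} //=.
  - by move=> s t u _ -> _ ->.
  - by move=> s s' t t' _ h1 _ h2; rewrite !big_cat /= h1 h2.
  - by move=> s t; rewrite !big_cat /= addrC.
  - by rewrite big_cons !big_nil addr0 mulr0.
  - by move=> a a' b; rewrite !big_cons !big_nil !addr0 /= phiD rmorphD mulrDl.
  - by move=> a b b'; rewrite !big_cons !big_nil !addr0 /= mulrDr.
  - move=> k a b; rewrite !big_cons !big_nil !addr0 /= phiZ rmorphM.
    by rewrite mulrCA mulrA.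
have := inv _ _ h; rewrite big_cons !big_nil addr0 /= phi1 rmorph1 mul1r.
by move/eqP; rewrite oner_eq0.
Qed.

HB.instance Definition _ := GRing.Zmodule_isComNzRing.Build tensor
  tens_mulA tens_mulC tens_mul1 tens_mulDl tens_1_neq0.

Definition tens (a : A) (b : B) : tensor := \pi_tensor [:: (a, b)].
Definition tensl (a : A) : tensor := tens a 1.
Definition tensr (b : B) : tensor := tens 1 b.

Let addE s t : \pi_tensor s + \pi_tensor t = \pi_tensor (s ++ t).
Proof. exact: tens_addE. Qed.
Let mulE s t : \pi_tensor s * \pi_tensor t = \pi_tensor (fs_mul s t).
Proof. exact: tens_mulE. Qed.

Lemma tensM a b : tens a b = tensl a * tensr b.
Proof.
apply: etrans (esym (mulE _ _)).
by rewrite /fs_mul /= mulr1 mul1r.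
Qed.

Fact tensl_is_zmod_morphism : zmod_morphism tensl.
Proof.
move=> a a'; apply/eqP; rewrite eq_sym subr_eq; apply/eqP.
rewrite -[in LHS](subrK a' a); apply: etrans (esym (addE _ _)).
exact/tensorP/tens_Dl.
Qed.
Fact tensl_is_monoid_morphism : monoid_morphism tensl.
Proof.
split=> // a a'; apply: etrans (esym (mulE _ _)).
by rewrite /fs_mul /= mulr1.
Qed.
HB.instance Definition _ :=
  GRing.isZmodMorphism.Build A tensor tensl tensl_is_zmod_morphism.
HB.instance Definition _ :=
  GRing.isMonoidMorphism.Build A tensor tensl tensl_is_monoid_morphism.

Fact tensr_is_zmod_morphism : zmod_morphism tensr.
Proof.
move=> b b'; apply/eqP; rewrite eq_sym subr_eq; apply/eqP.
rewrite -[in LHS](subrK b' b); apply: etrans (esym (addE _ _)).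
exact/tensorP/tens_Dr.
Qed.
Fact tensr_is_monoid_morphism : monoid_morphism tensr.
Proof.
split=> // b b'; apply: etrans (esym (mulE _ _)).
by rewrite /fs_mul /= mulr1.
Qed.
HB.instance Definition _ :=
  GRing.isZmodMorphism.Build B tensor tensr tensr_is_zmod_morphism.
HB.instance Definition _ :=
  GRing.isMonoidMorphism.Build B tensor tensr tensr_is_monoid_morphism.

Lemma tens_base k : tensl (f k) = tensr (g k).
Proof.
by apply/tensorP; have := tens_Z k 1 1; rewrite !mulr1.
Qed.

End FormalSums.

Section GeneratedAlgebra.
Variables (K : fieldType) (r : nat).

(* K[X, 1/det X] is presented as K[X, Y] / (Y det X - 1): the first r * r
   variables are the X_ij, the last one is Y = 1 / det X.  So an element of
   K[X, 1/det X] is given by a polynomial h, and [gl_eval f M y h] is its value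
   h(M), where f is the structure morphism and y must be the inverse of
   det M. *)
Definition gl_eval (R : comNzRingType) (f : K -> R) (M : 'M[R]_r) (y : R)
    (h : {mpoly K[r * r + 1]}) : R :=
  mmap f (fun k => (row_mx (mxvec M) y%:M : 'rV_(r * r + 1)) 0 k) h.

Variables (R : comUnitRingType) (f : {rmorphism K -> R}) (M : 'M[R]_r).

Definition Sigma : {pred R} :=
  [pred x | `[< exists h, x = gl_eval f M (\det M)^-1 h >]].

Definition Sigma_regular (s : R) : Prop :=
  s \in Sigma /\ (forall a, a \in Sigma -> s * a = 0 -> a = 0).

Definition Lambda : {pred R} :=
  [pred x | `[< exists2 s, Sigma_regular s & s * x \in Sigma >]].

Fact Sigma_subring : subring_closed Sigma.
Proof.
split=> [|x y|x y].
- by apply/asboolP; exists 1; rewrite /gl_eval rmorph1.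
- move=> /asboolP[h ->] /asboolP[h' ->]; apply/asboolP; exists (h - h').
  by rewrite /gl_eval rmorphB.
- move=> /asboolP[h ->] /asboolP[h' ->]; apply/asboolP; exists (h * h').
  by rewrite /gl_eval rmorphM.
Qed.
HB.instance Definition _ := GRing.isSubringClosed.Build R Sigma Sigma_subring.

Fact Sigma_regularM s t :
  Sigma_regular s -> Sigma_regular t -> Sigma_regular (s * t).
Proof.
move=> [Ss rs] [St rt]; split=> [|a Sa]; first exact: rpredM.
by rewrite -mulrA => /rs h; apply: rt => //; apply: h; apply: rpredM.
Qed.

Fact Sigma_Lambda x : x \in Sigma -> x \in Lambda.
Proof.
move=> Sx; apply/asboolP; exists 1; last by rewrite mul1r.
by split=> [|a _]; rewrite ?rpred1 ?mul1r.
Qed.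

Fact Lambda_subring : subring_closed Lambda.
Proof.
split=> [|x y|x y]; first by apply: Sigma_Lambda; apply: rpred1.
- move=> /asboolP[s rs Sx] /asboolP[t rt Sy]; apply/asboolP; exists (s * t).
    exact: Sigma_regularM.
  rewrite mulrBr mulrAC -[s * t * y]mulrA.
  by apply: rpredB; apply: rpredM => //; [case: rt | case: rs].
- move=> /asboolP[s rs Sx] /asboolP[t rt Sy]; apply/asboolP; exists (s * t).
    exact: Sigma_regularM.
  by rewrite mulrACA rpredM.
Qed.
HB.instance Definition _ := GRing.isSubringClosed.Build R Lambda Lambda_subring.

Record LambdaRing := MkLambda { Lambda_val : R; LambdaP : Lambda_val \in Lambda }.
HB.instance Definition _ := [isSub for Lambda_val].
HB.instance Definition _ := [Choice of LambdaRing by <:].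
HB.instance Definition _ := [SubChoice_isSubComNzRing of LambdaRing by <:].

Fact Sigma_const c : f c \in Sigma.
Proof. by apply/asboolP; exists c%:MP; rewrite /gl_eval mmapC. Qed.

Fact Sigma_coef i j : M i j \in Sigma.
Proof.
apply/asboolP; exists 'X_(lshift 1 (mxvec_index i j)).
by rewrite /gl_eval mmapX mmap1U row_mxEl mxvecE.
Qed.

Definition LambdaC (c : K) : LambdaRing := MkLambda (Sigma_Lambda (Sigma_const c)).

Fact LambdaC_is_zmod_morphism : zmod_morphism LambdaC.
Proof. by move=> x y; apply: val_inj; rewrite /= rmorphB. Qed.
Fact LambdaC_is_monoid_morphism : monoid_morphism LambdaC.
Proof. by split=> [|x y]; apply: val_inj; rewrite /= ?rmorph1 ?rmorphM. Qed.
HB.instance Definition _ :=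
  GRing.isZmodMorphism.Build K LambdaRing LambdaC LambdaC_is_zmod_morphism.
HB.instance Definition _ :=
  GRing.isMonoidMorphism.Build K LambdaRing LambdaC LambdaC_is_monoid_morphism.

Definition LambdaM : 'M[LambdaRing]_r :=
  \matrix_(i, j) MkLambda (Sigma_Lambda (Sigma_coef i j)).

End GeneratedAlgebra.

Section FractionField.
Variables (K : fieldType) (r : nat) (R : fieldType).
Variables (f : {rmorphism K -> R}) (M : 'M[R]_r).

Fact Lambda_divring : divring_closed (Lambda f M).
Proof.
have [L1 LB LM] := Lambda_subring f M.
have LV x : x \in Lambda f M -> x^-1 \in Lambda f M.
  have [-> | x0] := eqVneq x 0; first by rewrite invr0.
  move=> /asboolP[s rs Sx]; apply/asboolP.
  have s0 : s != 0.
    apply/eqP => s0; have := rs.2 1 (rpred1 _); rewrite s0 mul0r => /(_ erefl).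
    by move/eqP; rewrite oner_eq0.
  exists (s * x); last by rewrite mulfK //; case: rs.
  split=> // a _ /eqP; rewrite mulf_eq0 (negPf (mulf_neq0 s0 x0)).
  by move/eqP.
by split=> // x y Lx Ly; apply: LM => //; apply: LV.
Qed.
HB.instance Definition _ :=
  GRing.isDivringClosed.Build R (Lambda f M) Lambda_divring.
HB.instance Definition _ :=
  [SubNzRing_isSubUnitRing of LambdaRing f M by <:].
HB.instance Definition _ :=
  [SubComUnitRing_isSubIntegralDomain of LambdaRing f M by <:].
HB.instance Definition _ :=
  [SubIntegralDomain_isSubField of LambdaRing f M by <:].

End FractionField.

Definition reduced (R : nzRingType) : Prop :=
  forall (x : R) (n : nat), x ^+ n = 0 -> x = 0.

(* Separability of a commutative algebra over a field, in the sense of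
   Bourbaki (Algebra V, 15): it stays reduced under all extensions of the base
   field.  For a field extension, algebraic or not, this is the usual notion,
   and a finite product is separable if and only if every factor is. *)
Definition separable_algebra (K : fieldType) (A : comNzRingType)
    (f : {rmorphism K -> A}) : Prop :=
  forall (K1 : fieldType) (g : {rmorphism K -> K1}), reduced (tensor f g).

Definition regular_extension (K A : fieldType) (f : {rmorphism K -> A}) : Prop :=
  separable_algebra f /\ (forall a : A, algebraicOver f a -> exists c, a = f c).

(* The product decomposition of L is given by its projections L -> L_l; then
   the ideal L_l of L consists of the x with x_m = 0 for all m != l.  The
   indices l live in 'I_d, with successor l + 1 mod d given by [ordS]. *)
Record sigma_triple := SigmaTriple {
  st_d : nat;
  st_F : fieldType;
  st_E : fieldType;
  st_L : comUnitRingType;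
  st_Ll : 'I_st_d -> fieldType;
  st_FE : {rmorphism st_F -> st_E};
  st_EL : {rmorphism st_E -> st_L};
  st_pr : forall l, {rmorphism st_L -> st_Ll l};
  st_sigma : {rmorphism st_L -> st_L};
  st_d_gt0 : (0 < st_d)%N;
  st_product : forall x : (forall l, st_Ll l),
    exists! y : st_L, forall l, st_pr l y = x l;
  st_sigma_E : forall e, exists e', st_sigma (st_EL e) = st_EL e';
  st_sigma_L : forall l x, (forall m, m != l -> st_pr m x = 0) ->
    forall m, m != ordS l -> st_pr m (st_sigma x) = 0;
  st_fix_E : forall e, st_sigma (st_EL e) = st_EL e <-> exists c, e = st_FE c;
  st_fix_L : forall x, st_sigma x = x <-> exists c, x = st_EL (st_FE c);
  st_separable : separable_algebra st_EL
}.

(* The total ring of fractions of Sigma has been defined as the subring of the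
   x in L such that s x is in Sigma for some regular element s of Sigma.  This
   is legitimate because these s are invertible in L, so that Lambda consists
   of all fractions a / s. *)
Section RegularUnit.
Variables (T : sigma_triple) (r : nat).
Variables (Phi : 'M[st_E T]_r) (Psi : 'M[st_L T]_r).
Hypothesis Psi_unit : Psi \in unitmx.
Hypothesis Psi_eq : map_mx (st_sigma T) Psi = map_mx (st_EL T) Phi *m Psi.
Local Notation d := (st_d T).
Local Notation L := (st_L T).
Local Notation sg := (st_sigma T).
Local Notation Sig := (Sigma (st_EL T) Psi).

Let pr_inj (x y : L) : (forall l, st_pr l x = st_pr l y) -> x = y.
Proof.
move=> h; have [z [_ zu]] := st_product (fun l => st_pr l y).
by rewrite -(zu x h) -(zu y).
Qed.

Let pr_unit (x : L) : (forall l, st_pr l x != 0) -> x \is a GRing.unit.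
Proof.
move=> h; have [y [yP _]] := st_product (fun l => (st_pr l x)^-1).
apply/unitrPr; exists y; apply: pr_inj => l.
rewrite rmorphM rmorph1 yP mulfV; [by []|exact: h].
Qed.

Let det_inv_Sigma : (\det Psi)^-1 \in Sig.
Proof.
apply/asboolP; exists 'X_(rshift (r * r) ord0).
by rewrite /gl_eval mmapX mmap1U row_mxEr mxE.
Qed.

Let sigma_Sigma x : x \in Sig -> sg x \in Sig.
Proof.
move=> /asboolP[h ->]; rewrite /gl_eval /mmap rmorph_sum.
apply: rpred_sum => m _; rewrite rmorphM rpredM //.
  by have [e' ->] := st_sigma_E (h@_m); apply: Sigma_const.
rewrite /mmap1 rmorph_prod; apply: rpred_prod => k _; rewrite rmorphXn rpredX //.
case: (split_ordP k) => {}k ->.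
  rewrite row_mxEl; case/mxvec_indexP: k => i j; rewrite mxvecE.
  have -> : sg (Psi i j) = (map_mx sg Psi) i j by rewrite mxE.
  rewrite Psi_eq mxE; apply: rpred_sum => n _.
  by rewrite mxE rpredM ?Sigma_const ?Sigma_coef.
rewrite row_mxEr ord1 mxE eqxx mulr1n.
have detu : \det Psi \is a GRing.unit by rewrite -unitmxE.
rewrite rmorphV // -det_map_mx Psi_eq det_mulmx det_map_mx.
have dPhi : st_EL T (\det Phi) \is a GRing.unit.
  have : sg (\det Psi) \is a GRing.unit by apply: rmorph_unit.
  by rewrite -det_map_mx Psi_eq det_mulmx det_map_mx unitrM => /andP[].
rewrite invrM // rpredM // -rmorphV ?Sigma_const // unitfE.
by apply/eqP => d0; move: dPhi; rewrite d0 rmorph0 unitr0.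
Qed.

Let idem (l : 'I_d) : {e : L | forall m, st_pr m e = (m == l)%:R}.
Proof.
apply: cid; have [e [eP _]] := st_product (fun m : 'I_d => ((m == l)%:R : st_Ll m)).
by exists e.
Qed.

Let pr_sigma l x : (st_pr (ordS l) (sg x) == 0) = (st_pr l x == 0).
Proof.
pose e m := sval (idem m); have eP m n : st_pr n (e m) = (n == m)%:R := svalP (idem m) n.
have sum1 : \sum_m e m = 1.
  apply: pr_inj => n; rewrite rmorph_sum rmorph1 (bigD1 n) //= eP eqxx.
  rewrite big1 ?addr0 // => m; rewrite eP eq_sym => /negPf->; exact: mulr0n.
have se : st_pr (ordS l) (sg (e l)) = 1.
  rewrite -[RHS](rmorph1 (st_pr (ordS l))) -[in RHS](rmorph1 sg) -sum1.
  rewrite !rmorph_sum (bigD1 l) //= big1 ?addr0 // => m ml.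
  apply: (@st_sigma_L T m) => [n nm|]; first by rewrite eP (negPf nm).
  by rewrite (inj_eq (@ordS_inj _)) eq_sym.
apply/eqP/eqP => [h|h]; last first.
  have : x * e l = 0.
    apply: pr_inj => n; rewrite rmorphM rmorph0 eP.
    by case: eqP => [->|_]; rewrite ?h ?mul0r ?mulr0.
  move/(congr1 (fun y => st_pr (ordS l) (sg y))).
  by rewrite !rmorphM !rmorph0 se mulr1.
apply/eqP; apply: contra_eqT h => x0.
have [y [yP _]] := st_product (fun n => (st_pr n x)^-1).
have : x * (y * e l) = e l.
  apply: pr_inj => n; rewrite !rmorphM yP eP.
  by case: eqP => [->|_]; rewrite ?mulr0 // mulr1 mulfV.
move/(congr1 (fun y => st_pr (ordS l) (sg y))); rewrite rmorphM rmorphM se => h.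
by apply/eqP => h0; move/eqP: h; rewrite h0 mul0r eq_sym oner_eq0.
Qed.

Lemma Sigma_regular_unit s :
  Sigma_regular (st_EL T) Psi s -> s \is a GRing.unit.
Proof.
move=> [Ss sreg]; apply: pr_unit => l; apply/negP => /eqP sl.
pose sub m n := forall a, a \in Sig -> st_pr m a = 0 -> st_pr n a = 0.
have subS m n : sub (ordS m) (ordS n) -> sub m n.
  move=> h a Sa /eqP am; apply/eqP; rewrite -pr_sigma; apply/eqP.
  by apply: h; [apply: sigma_Sigma | apply/eqP; rewrite pr_sigma].
have ordSE t (i : 'I_d) : iter t (@ordS d) i = ((i + t) %% d)%N :> nat.
  elim: t => [|t ih] /=; first by rewrite addn0 modn_small.
  by rewrite ih -addn1 modnDml addn1 addnS.
have subT t m n : sub (iter t (@ordS d) m) (iter t (@ordS d) n) -> sub m n.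
  by elim: t => // t ih h; apply: ih; apply: subS; rewrite -!iterS.
(* sub m n only depends on n - m, hence is symmetric *)
have subsym m n : sub m n -> sub n m.
  move=> mn; pose c := (n + (d - m))%N; pose g := iter c (@ordS d).
  have gE i : g i = ((i + c) %% d)%N :> nat by exact: ordSE.
  have gm : g m = n.
    apply: val_inj; rewrite /= gE /c addnCA subnKC; last exact: ltnW.
    by rewrite modnDr modn_small.
  have shift i : sub i (g i).
    pose t := (m + (d - i))%N.
    have ti : iter t (@ordS d) i = m.
      apply: val_inj; rewrite /= ordSE /t addnCA subnKC; last exact: ltnW.
      by rewrite modnDr modn_small.
    apply: (subT t); rewrite ti /g -iterD addnC iterD ti.
    by rewrite -/(g m) gm.
  have many k i : sub i (iter k g i).
    by elim: k => [a //|k ih] a Sa ai; apply: shift => //; apply: ih.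
  have itE k i : iter k g i = ((i + k * c) %% d)%N :> nat.
    elim: k => [|k ih]; first by rewrite mul0n addn0 modn_small.
    by rewrite iterS gE ih modnDml -addnA mulSn [(k * c + c)%N]addnC.
  have := many d.-1 n; have -> // : iter d.-1 g n = m.
  apply: val_inj; rewrite /= itE -[in LHS]gm gE modnDml -addnA -mulSn.
  by rewrite prednK ?st_d_gt0 // addnC mulnC modnMDl modn_small.
have [N0 Nl] : exists2 N : {set 'I_d}, l \in N & forall m, (m \in N) = (st_pr m s == 0).
  by exists [set m | st_pr m s == 0] => [|m]; rewrite inE ?sl.
move=> NP.
have sep m : m \notin N0 ->
    exists a, [/\ a \in Sig, st_pr m a = 0 & st_pr l a != 0].
  move=> mN; apply: contrapT => no; move: mN; rewrite NP => /eqP; apply.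
  have ml : sub m l.
    move=> a Sa am; apply: contrapT => /eqP al; apply: no; by exists a.
  exact: subsym ml s Ss sl.
pose a m := if m \in N0 then 1 else xget 0 [set a | [/\ a \in Sig, st_pr m a = 0 & st_pr l a != 0]].
have aP m : [/\ a m \in Sig, m \notin N0 -> st_pr m (a m) = 0 & st_pr l (a m) != 0].
  rewrite /a; case: ifPn => mN; first by split; rewrite ?rpred1 // rmorph1 oner_eq0.
  by have [b bP] := sep m mN; case: xgetP => [c _ [? ? ?] //|/(_ b)]; case.
have A0 : \prod_m a m = 0.
  apply: sreg; first by apply: rpred_prod => m _; case: (aP m).
  apply: pr_inj => m; rewrite rmorphM rmorph0 rmorph_prod.
  have [mN|mN] := boolP (m \in N0).
    by move: mN; rewrite NP => /eqP->; rewrite mul0r.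
  by rewrite (bigD1 m) //=; case: (aP m) => _ -> // _; rewrite mul0r mulr0.
have : st_pr l (\prod_m a m) != 0.
  by rewrite rmorph_prod; apply/prodf_neq0 => m _; case: (aP m).
by rewrite A0 rmorph0 eqxx.
Qed.
End RegularUnit.

Section Statement.
Variables (T : sigma_triple) (r : nat).
Local Notation F := (st_F T).
Local Notation E := (st_E T).
Local Notation L := (st_L T).
Variable Psi : 'M[L]_r.

Definition st_El l : {rmorphism E -> st_Ll l} := st_pr l \o st_EL T.
Definition Lambda_ring := LambdaRing (st_EL T) Psi.
Definition Lambda_l_ring l := LambdaRing (st_El l) (map_mx (st_pr l) Psi).
Definition F_Lambda : {rmorphism F -> Lambda_ring} :=
  @LambdaC _ _ _ (st_EL T) Psi \o st_FE T.
Definition F_Lambda_l l : {rmorphism F -> Lambda_l_ring l} :=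
  @LambdaC _ _ _ (st_El l) (map_mx (st_pr l) Psi) \o st_FE T.

(* The ideal q, pulled back to F[X, Y]; it contains Y det X - 1. *)
Definition Gamma_ideal (h : {mpoly F[r * r + 1]}) : Prop :=
  let il := @tensl E L L (st_EL T) (st_EL T) in
  let ir := @tensr E L L (st_EL T) (st_EL T) in
  gl_eval (fun c => il (st_EL T (st_FE T c)))
    (map_mx il (invmx Psi) *m map_mx ir Psi)
    (il (\det Psi) * ir (\det Psi)^-1) h = 0.

Variables (F' : fieldType) (iF' : {rmorphism F -> F'}).

Definition Gamma_point (gamma : 'M[F']_r) : Prop :=
  gamma \in unitmx /\
  forall h, Gamma_ideal h -> gl_eval iF' gamma (\det gamma)^-1 h = 0.

(* Gamma_F' is the set of the primes P of F'[X, Y] containing q, and its closed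
   subsets are the V(I) = { P | I is contained in P }.  The point of Gamma_F'
   given by gamma is the ideal of all h with h(gamma) = 0.  The condition is
   that a closed subset containing all of these points is everything. *)
Definition Gamma_dense : Prop :=
  forall I : {pred {mpoly F'[r * r + 1]}},
    (forall gamma, Gamma_point gamma ->
       forall h, h \in I -> gl_eval id gamma (\det gamma)^-1 h = 0) ->
  forall P : {pred {mpoly F'[r * r + 1]}},
    idealr_closed P -> prime_idealr_closed P ->
    (forall h, Gamma_ideal h -> map_mpoly iF' h \in P) ->
  {subset I <= P}.

Definition Lambda' := tensor iF' F_Lambda.

Definition in_E' (z : Lambda') : Prop :=
  exists s : seq (F' * E), z = \sum_(p <- s) tens iF' F_Lambda p.1 (LambdaC _ _ p.2).

(* E'-algebra endomorphisms of Lambda' mapping Psi to Psi gamma, that is,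
   extending h(Psi) |-> h(Psi gamma).  Lambda' is the localization of Sigma'
   at the regular elements of Sigma, so there is at most one. *)
Definition extends_action (gamma : 'M[F']_r)
    (alpha : {rmorphism Lambda' -> Lambda'}) : Prop :=
  (forall c e, alpha (tens iF' F_Lambda c (LambdaC _ _ e)) =
               tens iF' F_Lambda c (LambdaC _ _ e)) /\
  let Psi' := map_mx (tensr iF' F_Lambda) (LambdaM (st_EL T) Psi) in
  map_mx alpha Psi' = Psi' *m map_mx (tensl iF' F_Lambda) gamma.

Definition Gamma_fixed (z : Lambda') : Prop :=
  forall gamma, Gamma_point gamma ->
  exists2 alpha, extends_action gamma alpha & alpha z = z.

End Statement.

(* Main.v *)
Require Import Defs.
From HB Require Import structures.
From mathcomp Require Import all_boot all_order all_algebra generic_quotient.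
From mathcomp Require Import ring.
From mathcomp Require Import boolp classical_sets.
From mathcomp Require Import mpoly.

Set Implicit Arguments.
Unset Strict Implicit.
Unset Printing Implicit Defensive.

Import GRing.Theory.
Local Open Scope ring_scope.
Local Open Scope quotient_scope.

(* Write Psi_1, Psi_2 for the two images of Psi in L (x)_E L, so that q consists
   of the h with h(G) = 0 for G = Psi_1^-1 Psi_2.

   If z = b / s in Lambda' is fixed by Gamma(F'), with b = h(Psi), s = k(Psi),
   then h(Psi X) s - b k(Psi X) vanishes at all points of Gamma(F').  Expanding
   its coefficients over F' and using that Gamma(F') is dense, it is nilpotent,
   hence zero, at X = G in the reduced ring L (x)_E Lambda'.  This says that
   z (x) 1 = 1 (x) z, and a linear form L -> E with value 1 at 1 gives z in E'.
   Only the separability of L / E and the reducedness of Lambda' are used here.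

   Conversely, Gamma(F') acts on Lambda': if h(Psi) = 0, then h(Psi_1 X) vanishes
   at X = G, and as G is sigma-invariant and the constants of L are F, relations
   over L between the values at G come from relations over F, which persist at
   gamma.  The translate of a regular element is regular because gamma is
   invertible, hence a unit because Lambda' is integral over the von Neumann
   regular ring Lambda. *)

(** * Linear forms and tensor products over a field *)

Section LinearForms.
Variables (K : fieldType) (A : comNzRingType) (f : {rmorphism K -> A}).

Definition linear_form (phi : A -> K) : Prop :=
  {morph phi : x y / x + y} /\ forall k x, phi (f k * x) = k * phi x.

Lemma linear_form_sum phi I (s : seq I) (G : I -> A) : linear_form phi ->
  phi (\sum_(i <- s) G i) = \sum_(i <- s) phi (G i).
Proof.
move=> [phiD phiZ]; apply: (big_morph phi) => //.
by have := phiZ 0 0; rewrite !mul0r rmorph0 mul0r.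
Qed.

(** A subspace [W] maximal among those avoiding [y] is a complement of the line [K y], and [phi] is
    the coordinate along [y]. *)
Lemma exists_form_at y : y != 0 -> exists2 phi, linear_form phi & phi y = 1.
Proof.
move=> y0; pose P (W : set A) := ~ W y /\ (forall k u v, W u -> W v -> W (f k * u + v)).
have [|W [[Wy Wlin] Wmax]] := @Zorn_bigcup A P.
  move=> C CP Ctot; split; first by move=> [X CX Xy]; case: (CP _ CX) => + _; apply.
  move=> k u v [X CX Xu] [Y CY Yv]; case: (Ctot _ _ CX CY) => sub.
    by exists Y => //; case: (CP _ CY) => _; apply => //; apply: sub.
  by exists X => //; case: (CP _ CX) => _; apply => //; apply: sub.
have maxE V : P V -> (forall x, W x -> V x) -> forall x, V x -> W x.
  move=> PV WV x Vx; apply: contrapT => nWx.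
  by apply: (Wmax V) PV; split=> // sub; apply/nWx/sub.
(* The empty set satisfies [P], as the union of the empty chain must, so that [W] contains 0 has to
   come from maximality. *)
have W0 : W 0.
  apply: (maxE (fun x => W x \/ x = 0)); [|by left|by right].
  split; first by move=> [//|/eqP]; rewrite (negPf y0).
  move=> k u v [Wu|->] [Wv|->].
  - by left; apply: Wlin.
  - left; have := Wlin (k - 1) u u Wu Wu.
    by rewrite rmorphB rmorph1 mulrBl mul1r subrK addr0.
  - by left; rewrite mulr0 add0r.
  - by right; rewrite mulr0 addr0.
have WZ k x : W x -> W (f k * x) by move=> Wx; rewrite -[_ * _]addr0; apply: Wlin.
have decomp x : exists k, W (x - f k * y).
  have [Wx|nWx] := pselect (W x); first by exists 0; rewrite rmorph0 mul0r subr0.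
  (* Either [y] lies in [W + K x] and one solves for [x], or [W + K x] still avoids [y] and
     maximality puts [x] in [W]. *)
  have [[w [k [Ww yE]]]|noV] := pselect (exists w k, W w /\ y = w + f k * x).
    have k0 : k != 0.
      by apply/eqP => k0; apply: Wy; rewrite yE k0 rmorph0 mul0r addr0.
    exists k^-1; suff -> : x - f k^-1 * y = f (- k^-1) * w by apply: WZ.
    rewrite yE mulrDr mulrA -rmorphM mulVf // rmorph1 mul1r rmorphN mulNr.
    by rewrite opprD addrCA subrr addr0.
  case: nWx; apply: (maxE (fun v => exists w k, W w /\ v = w + f k * x)).
  - split; first by move=> [w [k ?]]; apply: noV; exists w, k.
    move=> c _ _ [w [k [Ww ->]]] [w' [k' [Ww' ->]]].
    exists (f c * w + w'), (c * k + k'); split; first exact: Wlin.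
    by rewrite rmorphD rmorphM mulrDr mulrDl !mulrA addrACA.
  - by move=> v Wv; exists v, 0; rewrite rmorph0 mul0r addr0.
  - by exists 0, 1; rewrite rmorph1 mul1r add0r.
have [phi phiP] := choice decomp.
have phiE x k : W (x - f k * y) -> phi x = k.
  move=> h; apply/eqP; rewrite -subr_eq0; apply/contraT => k0; case: Wy.
  have -> : y = f (phi x - k)^-1 * (f (-1) * (x - f (phi x) * y) + (x - f k * y)).
    rewrite rmorphN1 mulN1r opprB addrA subrK -mulrBl -rmorphB mulrA -rmorphM.
    by rewrite mulVf // rmorph1 mul1r.
  by apply: WZ; apply: Wlin.
exists phi; last by apply: phiE; rewrite rmorph1 mul1r subrr.
split=> [u v|k u]; apply: phiE.
  rewrite rmorphD mulrDl opprD addrACA -[u - _]mul1r -(rmorph1 f).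
  exact: Wlin.
by rewrite rmorphM -mulrA -mulrBr; apply: WZ.
Qed.

(** Replaces a basis of the span of [s], with coordinates given by linear forms on all of [A]. Each
    new [y] is corrected to [q y], and the new form [psi \o q] vanishes on the earlier elements. *)
Lemma dual_frame (s : seq A) : exists (m : nat) (a : 'I_m -> A) (phi : 'I_m -> A -> K),
  (forall i, linear_form (phi i)) /\
  {in s, forall x, x = \sum_i f (phi i x) * a i}.
Proof.
elim: s => [|y s [m [a [phi [phiL sE]]]]].
  by exists 0%N, (fun=> 0), (fun _ _ => 0); split=> [[]|].
pose p x := \sum_i f (phi i x) * a i; pose q x := x - p x.
have pD : {morph p : u v / u + v}.
  move=> u v; rewrite /p -big_split; apply: eq_bigr => i _ /=.
  by rewrite (phiL i).1 rmorphD mulrDl.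
have pZ k u : p (f k * u) = f k * p u.
  rewrite /p mulr_sumr; apply: eq_bigr => i _.
  by rewrite (phiL i).2 rmorphM mulrA.
have [q0|/exists_form_at[psi [psiD psiZ] psiq]] := eqVneq (q y) 0.
  exists m, a, phi; split=> // x; rewrite inE => /predU1P[->|/sE//].
  by apply/eqP; rewrite -subr_eq0; apply/eqP.
have psi0 : psi 0 = 0 by have := psiZ 0 0; rewrite !mul0r rmorph0 mul0r.
pose b (i : 'I_m.+1) := if unlift ord0 i is Some j then a j else q y.
pose chi (i : 'I_m.+1) := if unlift ord0 i is Some j then phi j else psi \o q.
have sumE x : \sum_i f (chi i x) * b i = f (psi (q x)) * q y + p x.
  rewrite big_ord_recl /chi /b unlift_none; congr (_ + _).
  by apply: eq_bigr => i _; rewrite liftK.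
exists m.+1, b, chi; split=> [i|x].
  rewrite /chi; case: unliftP => [j _|_]; first exact: phiL.
  split=> [u v|k u] /=.
    by rewrite /q pD opprD addrACA [LHS]psiD.
  by rewrite /q pZ -mulrBr psiZ.
rewrite sumE inE => /predU1P[->|xs]; first by rewrite psiq rmorph1 mul1r subrK.
have xE : x = p x by exact: sE.
by rewrite /q -xE subrr psi0 rmorph0 mul0r add0r.
Qed.

End LinearForms.

(** * Tensor products over a field: universal property and contractions *)

Section Tensors.
Variables (K : fieldType) (A B : comNzRingType).
Variables (f : {rmorphism K -> A}) (g : {rmorphism K -> B}).
Local Notation T := (tensor f g).
Local Notation tl := (tensl f g).
Local Notation tr := (tensr f g).

Lemma pi_tensor_sum s : \pi_(tensor f g) s = \sum_(p <- s) tens f g p.1 p.2.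
Proof.
elim: s => [|[a b] s ih]; first by rewrite big_nil.
by rewrite big_cons -ih /= -[in LHS]cat1s; apply/esym/tens_addE.
Qed.

Lemma tensor_sum (w : T) : w = \sum_(p <- repr w) tl p.1 * tr p.2.
Proof.
rewrite -{1}[w]reprK pi_tensor_sum; apply: eq_bigr => p _; exact: tensM.
Qed.

Lemma tensor_rmorph_ext (C : pzRingType) (u v : {rmorphism T -> C}) :
  (forall a, u (tl a) = v (tl a)) -> (forall b, u (tr b) = v (tr b)) -> u =1 v.
Proof.
move=> hl hr w; rewrite (tensor_sum w) !rmorph_sum; apply: eq_bigr => p _.
by rewrite !rmorphM hl hr.
Qed.

Section Lift.
Variables (C : comNzRingType) (u : {rmorphism A -> C}) (v : {rmorphism B -> C}).
Hypothesis uv : forall k, u (f k) = v (g k).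

Let S (s : seq (A * B)) := \sum_(p <- s) u p.1 * v p.2.

Let S_rel s t : tens_rel f g s t -> S s = S t.
Proof.
rewrite /S; elim=> {s t} //=.
- by move=> s t u' _ -> _ ->.
- by move=> s s' t t' _ h1 _ h2; rewrite !big_cat /= h1 h2.
- by move=> s t; rewrite !big_cat /= addrC.
- by rewrite big_cons !big_nil addr0 rmorph0 mul0r.
- by move=> a a' b; rewrite !big_cons !big_nil !addr0 /= rmorphD mulrDl.
- by move=> a b b'; rewrite !big_cons !big_nil !addr0 /= rmorphD mulrDr.
- by move=> k a b; rewrite !big_cons !big_nil !addr0 /= !rmorphM -uv mulrCA mulrA.
Qed.

(** The universal map out of the tensor product. It takes the compatibility proof as an argument so
    that the morphism structures can be attached to it. *)
Definition tens_lift of (forall k, u (f k) = v (g k)) :=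
  fun w : T => \sum_(p <- repr w) u p.1 * v p.2.

Let lift_pi s : tens_lift uv (\pi_(tensor f g) s) = S s.
Proof. exact/S_rel/tens_repr. Qed.

Fact tens_lift_is_zmod_morphism : zmod_morphism (tens_lift uv).
Proof.
move=> x y; rewrite -[x]reprK -[y]reprK.
have -> : \pi_(tensor f g) (repr x) - \pi_(tensor f g) (repr y)
        = \pi_(tensor f g) (repr x ++ fs_opp (repr y)).
  by rewrite [- _]tens_oppE; apply: tens_addE.
rewrite !lift_pi /S big_cat /= big_map -sumrN; congr (_ + _).
by apply: eq_bigr => p _; rewrite rmorphN mulNr.
Qed.
Fact tens_lift_is_monoid_morphism : monoid_morphism (tens_lift uv).
Proof.
split=> [|x y]; first by rewrite lift_pi /S big_seq1 !rmorph1 mulr1.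
rewrite -[x]reprK -[y]reprK [_ * _]tens_mulE !lift_pi /S /fs_mul.
rewrite big_allpairs_dep mulr_suml; apply: eq_bigr => p _.
by rewrite mulr_sumr; apply: eq_bigr => q _; rewrite !rmorphM mulrACA.
Qed.
HB.instance Definition _ :=
  GRing.isZmodMorphism.Build T C (tens_lift uv) tens_lift_is_zmod_morphism.
HB.instance Definition _ :=
  GRing.isMonoidMorphism.Build T C (tens_lift uv) tens_lift_is_monoid_morphism.

Lemma tens_liftl a : tens_lift uv (tl a) = u a.
Proof. by rewrite lift_pi /S big_seq1 rmorph1 mulr1. Qed.
Lemma tens_liftr b : tens_lift uv (tr b) = v b.
Proof. by rewrite lift_pi /S big_seq1 rmorph1 mul1r. Qed.
End Lift.

(** This is [phi (x) id], with [K (x)_K B] identified with [B]. *)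
Definition contract (phi : A -> K) (w : T) : B := \sum_(p <- repr w) g (phi p.1) * p.2.

Section Contract.
Variables (phi : A -> K) (phiL : linear_form f phi).

Let S_rel s t : tens_rel f g s t ->
  \sum_(p <- s) g (phi p.1) * p.2 = \sum_(p <- t) g (phi p.1) * p.2.
Proof.
case: phiL => phiD phiZ; elim=> {s t} //=.
- by move=> s t u' _ -> _ ->.
- by move=> s s' t t' _ h1 _ h2; rewrite !big_cat /= h1 h2.
- by move=> s t; rewrite !big_cat /= addrC.
- by rewrite big_cons !big_nil addr0 mulr0.
- by move=> a a' b; rewrite !big_cons !big_nil !addr0 /= phiD rmorphD mulrDl.
- by move=> a b b'; rewrite !big_cons !big_nil !addr0 /= mulrDr.
- by move=> k a b; rewrite !big_cons !big_nil !addr0 /= phiZ rmorphM mulrCA mulrA.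
Qed.

Lemma contract_pi s : contract phi (\pi_(tensor f g) s) = \sum_(p <- s) g (phi p.1) * p.2.
Proof. exact/S_rel/tens_repr. Qed.

Lemma contractD : {morph contract phi : x y / x + y}.
Proof.
move=> x y; rewrite -[x]reprK -[y]reprK.
have -> : \pi_(tensor f g) (repr x) + \pi_(tensor f g) (repr y)
        = \pi_(tensor f g) (repr x ++ repr y) by apply: tens_addE.
by rewrite !contract_pi big_cat.
Qed.

Lemma contract0 : contract phi 0 = 0.
Proof. by rewrite contract_pi big_nil. Qed.

Lemma contract_sum I (s : seq I) (G : I -> T) :
  contract phi (\sum_(i <- s) G i) = \sum_(i <- s) contract phi (G i).
Proof. apply: (big_morph _ contractD contract0). Qed.

Lemma contractM a b : contract phi (tl a * tr b) = g (phi a) * b.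
Proof. by rewrite -tensM contract_pi big_seq1. Qed.

Lemma contract_tensr b : phi 1 = 1 -> contract phi (tr b) = b.
Proof. by move=> h; have := contractM 1 b; rewrite rmorph1 mul1r h rmorph1 mul1r. Qed.

End Contract.

(** The left factors of a representative of [w] lie in the span of a finite frame; collecting terms
    leaves contractions of [w] as coefficients. *)
Lemma tens_frame (w : T) : exists (m : nat) (d : 'I_m -> A) (phi : 'I_m -> A -> K),
  (forall i, linear_form f (phi i)) /\
  w = \sum_i tl (d i) * tr (contract (phi i) w).
Proof.
have [m [d [phi [phiL dE]]]] := dual_frame f [seq p.1 | p <- repr w].
exists m, d, phi; split=> //.
rewrite {1}(tensor_sum w) big_seq (eq_bigr (fun p =>
    \sum_i tl (d i) * tr (g (phi i p.1) * p.2))).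
  rewrite -big_seq exchange_big; apply: eq_bigr => i _ /=.
  by rewrite -mulr_sumr -rmorph_sum.
move=> p pw; rewrite {1}(dE p.1) ?map_f // rmorph_sum mulr_suml.
apply: eq_bigr => i _; rewrite !rmorphM /= -tens_base.
by rewrite mulrA [tl (f _) * _]mulrC.
Qed.

(** Reduces vanishing in [A (x) B] to vanishing in [B], without a choice of bases. *)
Lemma contract_separates (w : T) :
  (forall phi, linear_form f phi -> contract phi w = 0) -> w = 0.
Proof.
move=> h; have [m [d [phi [phiL ->]]]] := tens_frame w.
by rewrite big1 // => i _; rewrite h ?rmorph0 ?mulr0.
Qed.

Lemma tensr_inj : injective tr.
Proof.
move=> b b' bb'; have [phi phiL phi1] := exists_form_at f (oner_neq0 A).
by rewrite -(contract_tensr phiL b phi1) bb' (contract_tensr phiL).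
Qed.

End Tensors.

Section TensorMap.
Variables (K : fieldType) (A B C : comNzRingType).
Variables (f : {rmorphism K -> A}) (g : {rmorphism K -> B}) (h : {rmorphism K -> C}).
Variables (v : {rmorphism B -> C}) (vg : forall k, v (g k) = h k).

Fact tens_mapr_comp k : tensl f h (f k) = tensr f h (v (g k)).
Proof. by rewrite vg tens_base. Qed.

Definition tens_mapr : {rmorphism tensor f g -> tensor f h} :=
  @tens_lift _ _ _ f g _ (tensl f h) (tensr f h \o v) tens_mapr_comp.

Lemma tens_maprl a : tens_mapr (tensl f g a) = tensl f h a.
Proof. exact: tens_liftl. Qed.
Lemma tens_maprr b : tens_mapr (tensr f g b) = tensr f h (v b).
Proof. exact: tens_liftr. Qed.

Lemma contract_mapr phi w : linear_form f phi ->
  contract phi (tens_mapr w) = v (contract phi w).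
Proof.
move=> phiL; rewrite (tensor_sum w) rmorph_sum !contract_sum // rmorph_sum.
apply: eq_bigr => p _; rewrite !rmorphM tens_maprl tens_maprr.
by rewrite !contractM // rmorphM vg.
Qed.

(** Contractions commute with [id (x) v] and detect zero. *)
Lemma tens_mapr_inj : injective v -> injective tens_mapr.
Proof.
move=> vI; apply: raddf_inj => w w0; apply: contract_separates => phi phiL.
by apply: vI; rewrite -contract_mapr // w0 contract0 // rmorph0.
Qed.
End TensorMap.

(** * Maps to fields *)

Section PrimeQuotient.
Variables (R : comNzRingType) (I : prime_idealr R).
Local Notation Q := {ideal_quot I}.

(** Units and inverses of the quotient are chosen classically, because [idomainType] is built on
    rings with inverses. *)
Let unitq : pred Q := fun x => `[< exists y, y * x = 1 >].
Let invq (x : Q) : Q := if unitq x then xget x [set y | y * x = 1]%classic else x.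

Fact invq_mul : {in unitq, left_inverse 1 invq *%R}.
Proof.
move=> x xu; rewrite /invq ifT //; case/asboolP: xu => y yx.
by case: xgetP => [z _ //|/(_ y)]; case.
Qed.
Fact invq_unit (x y : Q) : y * x = 1 -> unitq x.
Proof. by move=> yx; apply/asboolP; exists y. Qed.
Fact invq_out : {in [predC unitq], invq =1 id}.
Proof. by move=> x xu; rewrite /invq ifN. Qed.
Fact rquot_integral (x y : Q) : x * y = 0 -> (x == 0) || (y == 0).
Proof. exact: Quotient.rquot_IdomainAxiom. Qed.

Lemma prime_ideal_field : exists (F : fieldType) (h : {rmorphism R -> F}),
  forall x, (h x == 0) = (x \in I).
Proof.
pose U := HB.pack_for comUnitRingType Q
  (GRing.ComNzRing_hasMulInverse.Build Q invq_mul invq_unit invq_out).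
pose D := HB.pack_for idomainType U
  (GRing.ComUnitRing_isIntegral.Build U rquot_integral).
pose p : {rmorphism R -> D} := [the {rmorphism R -> Q} of \pi_Q].
exists {fraction D}, (@FracField.tofrac D \o p) => x /=.
rewrite tofrac_eq0 -[x in RHS]subr0 Quotient.idealrBE -(rmorph0 p).
by [].
Qed.
End PrimeQuotient.

(** An ideal [J] maximal among those avoiding the powers of [x] is prime, and [x] survives in the
    fraction field of [R / J]. *)
Lemma not_nilpotent_field (R : comNzRingType) (x : R) :
  (forall n, x ^+ n != 0) -> exists (F : fieldType) (h : {rmorphism R -> F}), h x != 0.
Proof.
move=> xn.
pose P (J : set R) := (forall n, ~ J (x ^+ n)) /\
  (forall a u v, J u -> J v -> J (a * u + v)).
have [|J [[Jx Jlin] Jmax]] := @Zorn_bigcup R P.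
  move=> C CP Ctot; split; first by move=> n [X CX Xn]; case: (CP _ CX) => /(_ n).
  move=> a u v [X CX Xu] [Y CY Yv]; case: (Ctot _ _ CX CY) => sub.
    by exists Y => //; case: (CP _ CY) => _; apply => //; apply: sub.
  by exists X => //; case: (CP _ CX) => _; apply => //; apply: sub.
have maxE V : P V -> (forall u, J u -> V u) -> forall u, V u -> J u.
  move=> PV JV u Vu; apply: contrapT => nJu.
  by apply: (Jmax V) PV; split=> // sub; apply/nJu/sub.
have J0 : J 0.
  apply: (maxE (fun u => J u \/ u = 0)); [|by left|by right].
  split; first by move=> n [/Jx //|/eqP]; rewrite (negPf (xn n)).
  move=> a u v [Ju|->] [Jv|->].
  - by left; apply: Jlin.
  - left; have := Jlin (a - 1) u u Ju Ju.
    by rewrite mulrBl mul1r subrK addr0.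
  - by left; rewrite mulr0 add0r.
  - by right; rewrite mulr0 addr0.
have JM a u : J u -> J (a * u) by move=> Ju; rewrite -[_ * _]addr0; apply: Jlin.
have JD u v : J u -> J v -> J (u + v) by move=> Ju Jv; rewrite -[u]mul1r; apply: Jlin.
(* By maximality, [J + R u] contains a power of [x] as soon as [u] is outside [J]. *)
have pow u : ~ J u -> exists n a, J (x ^+ n - a * u).
  move=> nJu; apply: contrapT => no; apply: nJu.
  apply: (maxE (fun v => exists a, J (v - a * u))); last by exists 1; rewrite mul1r subrr.
    split=> [n [a ?]|c v w [a Ja] [b Jb]]; first by apply: no; exists n, a.
    exists (c * a + b); rewrite mulrDl opprD addrACA -mulrA -mulrBr.
    exact: Jlin.
  by move=> v Jv; exists 0; rewrite mul0r subr0.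
pose I : {pred R} := [pred u | `[< J u >]].
have Iideal : idealr_closed I.
  split=> [|| a u v]; first exact/asboolP.
    by apply/asboolP; have := Jx 0%N; rewrite expr0.
  by move=> /asboolP Ju /asboolP Jv; apply/asboolP/Jlin.
have Iprime : prime_idealr_closed I.
  move=> u v /asboolP Juv; apply/orP; apply: contrapT => /orP.
  rewrite negb_or => /andP[/asboolP /pow[n [a Ja]] /asboolP /pow[m [b Jb]]].
  apply: (Jx (n + m)%N); rewrite exprD.
  have -> : x ^+ n * x ^+ m = x ^+ m * (x ^+ n - a * u) + (a * u * (x ^+ m - b * v)
          + a * b * (u * v)) by ring.
  exact: JD (JM _ _ Ja) (JD _ _ (JM _ _ Jb) (JM _ _ Juv)).
pose PI : prime_idealr R := HB.pack_for (prime_idealr R) I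
  (isPrimeIdealrClosed.Build R I Iprime) (isIdealr.Build R I Iideal).
have [F [h hE]] := prime_ideal_field PI.
exists F, h; rewrite hE; apply/negP => /asboolP; rewrite -[x]expr1; exact: Jx.
Qed.

(** * Polynomials, localization and integrality *)

Section Mpoly.
Variables (n : nat).

Lemma rmorph_mmap (R S S' : comNzRingType) (psi : {rmorphism S -> S'}) (f : R -> S)
    (p : 'I_n -> S) (h : {mpoly R[n]}) :
  psi (mmap f p h) = mmap (fun x => psi (f x)) (fun i => psi (p i)) h.
Proof.
rewrite /mmap rmorph_sum; apply: eq_bigr => m _; rewrite rmorphM /=; congr (_ * _).
by rewrite /mmap1 rmorph_prod; apply: eq_bigr => i _; rewrite rmorphXn.
Qed.

Lemma eq_mmap (R S : comNzRingType) (f f' : R -> S) (p p' : 'I_n -> S) (h : {mpoly R[n]}) :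
  f =1 f' -> p =1 p' -> mmap f p h = mmap f' p' h.
Proof.
move=> ff' pp'; rewrite /mmap; apply: eq_bigr => m _.
by rewrite ff' (mmap1_eq _ pp').
Qed.

(** Splits [Q] into polynomials [H i] over [K] along a frame of its coefficients. Since [H i] takes
    at a [K]-point a linear form of the value of [Q], every [H i] vanishes at the [K]-points where
    [Q] does. *)
Lemma mpoly_frame (K : fieldType) (A : comNzRingType) (f : {rmorphism K -> A})
    (Q : {mpoly A[n]}) :
  exists (m : nat) (a : 'I_m -> A) (H : 'I_m -> {mpoly K[n]}),
  [/\ forall (C : comNzRingType) (c : {rmorphism A -> C}) (p : 'I_n -> C),
        mmap c p Q = \sum_i c (a i) * mmap (fun k => c (f k)) p (H i)
    & forall i, exists2 phi, linear_form f phi &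
      forall p : 'I_n -> K, mmap id p (H i) = phi (mmap id (fun k => f (p k)) Q)].
Proof.
have [m [a [phi [phiL aE]]]] := dual_frame f [seq Q@_m | m <- msupp Q].
exists m, a, (fun i => \sum_(m <- msupp Q) phi i Q@_m *: 'X_[m]); split.
  move=> C c p; pose fc : {rmorphism K -> C} := c \o f.
  under eq_bigr => i _.
    rewrite (_ : mmap _ _ _ = \sum_(m <- msupp Q) c (f (phi i Q@_m)) * mmap1 p m).
      over.
    rewrite (raddf_sum (mmap fc p)) /=; apply: eq_bigr => u _.
    by rewrite mmapZ mmapX.
  under eq_bigr do rewrite mulr_sumr.
  rewrite exchange_big /=; rewrite /mmap big_seq [RHS]big_seq.
  apply: eq_bigr => u uQ.
  rewrite {1}[Q@_u]aE; last by apply/mapP; exists u.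
  rewrite rmorph_sum mulr_suml.
  by apply: eq_bigr => i _; rewrite rmorphM mulrCA mulrA.
move=> i; exists (phi i) => // p; rewrite {2}/mmap (linear_form_sum _ _ (phiL i)).
rewrite (raddf_sum (mmap idfun p)) /=; apply: eq_bigr => u _.
rewrite (mmapZ p idfun) (mmapX p idfun) /= mulrC.
rewrite [Q@_u * _]mulrC (_ : mmap1 _ u = f (mmap1 p u)) ?(phiL i).2 //.
by rewrite /mmap1 rmorph_prod; apply: eq_bigr => k _; rewrite rmorphXn.
Qed.
End Mpoly.

Section GLPoint.
Variable r : nat.

(** The coordinates of the point at which [gl_eval] evaluates. *)
Definition gl_pt (R : pzRingType) (M : 'M[R]_r) (y : R) : 'I_(r * r + 1) -> R :=
  fun k => (row_mx (mxvec M) y%:M : 'rV_(r * r + 1)) 0 k.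

Lemma gl_pt_map (R S : pzRingType) (psi : {rmorphism R -> S}) M y k :
  psi (gl_pt M y k) = gl_pt (map_mx psi M) (psi y) k.
Proof.
rewrite /gl_pt; case: (split_ordP k) => {}k ->.
  by rewrite !row_mxEl; case/mxvec_indexP: k => i j; rewrite !mxvecE mxE.
by rewrite !row_mxEr !ord1 !mxE eqxx !mulr1n.
Qed.

Definition gl_X (R : comNzRingType) : 'M[{mpoly R[r * r + 1]}]_r :=
  \matrix_(i, j) 'X_(lshift 1 (mxvec_index i j)).
Definition gl_Y (R : comNzRingType) : {mpoly R[r * r + 1]} := 'X_(rshift (r * r) ord0).

Lemma mmap_gl_X (R S : comNzRingType) (f : {rmorphism R -> S}) M y :
  map_mx (mmap f (gl_pt M y)) (gl_X R) = M.
Proof. by apply/matrixP => i j; rewrite !mxE mmapX mmap1U /gl_pt row_mxEl mxvecE. Qed.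

Lemma mmap_gl_Y (R S : comNzRingType) (f : {rmorphism R -> S}) (M : 'M_r) y :
  mmap f (gl_pt M y) (gl_Y R) = y.
Proof. by rewrite mmapX mmap1U /gl_pt row_mxEr mxE eqxx mulr1n. Qed.

End GLPoint.

Section Localization.
Variables (P A C : comNzRingType) (u : {rmorphism P -> A}) (v : {rmorphism P -> C}).

(** The universal property of localization: [x = u h / u k] has to go to [v h / v k], and
    cross-multiplication shows that this does not depend on the fraction chosen. *)
Lemma extend_to_fractions :
  (forall h, u h = 0 -> v h = 0) ->
  (forall x, exists k h c, u k * x = u h /\ v k * c = 1) ->
  exists w : {rmorphism A -> C}, forall h, w (u h) = v h.
Proof.
move=> uv0 frac.
pose rel x y := exists k h c, [/\ u k * x = u h, v k * c = 1 & y = v h * c].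
have [w wP] := choice (fun x : A => let: ex_intro k (ex_intro h (ex_intro c (conj e1 e2))) :=
  frac x in ex_intro (rel x) (v h * c)
    (ex_intro _ k (ex_intro _ h (ex_intro _ c (And3 e1 e2 erefl))))).
have wE x y : rel x y -> w x = y.
  case: (wP x) => k [h [c [kx kc ->]]] [k' [h' [c' [kx' kc' ->]]]].
  have /uv0/eqP : u (k' * h - k * h') = 0.
    by rewrite rmorphB !rmorphM -kx -kx' mulrCA subrr.
  rewrite rmorphB !rmorphM subr_eq0 => /eqP e.
  transitivity (v k' * v h * c * c'); last by rewrite e; ring: kc.
  by ring: kc'.
have wu h : w (u h) = v h.
  by apply: wE; exists 1, h, 1; rewrite !rmorph1 !mul1r mulr1.
have wB : zmod_morphism w.
  move=> x y; apply: wE; case: (wP x) (wP y) => k [h [c [kx kc ->]]] [k' [h' [c' [ky kc' ->]]]].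
  exists (k * k'), (k' * h - k * h'), (c * c'); split.
  - by rewrite rmorphB !rmorphM -kx -ky; ring.
  - by rewrite rmorphM mulrACA kc kc' mulr1.
  - by rewrite rmorphB !rmorphM; ring: kc kc'.
have wM : monoid_morphism w.
  split=> [|x y]; first by rewrite -(rmorph1 u) wu rmorph1.
  apply: wE; case: (wP x) (wP y) => k [h [c [kx kc ->]]] [k' [h' [c' [ky kc' ->]]]].
  exists (k * k'), (h * h'), (c * c'); split.
  - by rewrite !rmorphM -kx -ky; ring.
  - by rewrite rmorphM mulrACA kc kc' mulr1.
  - by rewrite !rmorphM mulrACA.
pose w' : {rmorphism A -> C} := HB.pack_for {rmorphism A -> C} w
  (GRing.isZmodMorphism.Build A C w wB) (GRing.isMonoidMorphism.Build A C w wM).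
by exists w'.
Qed.
End Localization.

(* Induction on a monic equation of x over R: on the part where the constant
   term is invertible x divides it; on the complementary part the constant term
   vanishes and one factor x can be cancelled. *)
Lemma integral_regular_unit (R A : comNzRingType) (f : {rmorphism R -> A}) (x : A) :
  (forall a : R, exists b, a * a * b = a) -> (forall y, x * y = 0 -> y = 0) ->
  integralOver f x -> exists y, x * y = 1.
Proof.
move=> vnr xreg [p pmon /eqP px].
have main (q : {poly R}) : q \is monic -> forall e : A, e * (map_poly f q).[x] = 0 ->
    exists y, x * y = e.
  elim/poly_ind: q => [|q a ih] qmon e; first by rewrite monicE lead_coef0 eq_sym oner_eq0 in qmon.
  have [q0|q0] := eqVneq q 0.
    move: qmon; rewrite q0 mul0r add0r monicE lead_coefC => /eqP->.
    rewrite rmorph1 hornerC mulr1 => ->; by exists 0; rewrite mulr0.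
  have qm : q \is monic.
    move: qmon; rewrite !monicE lead_coefDl ?lead_coefMX // size_mulX // size_polyC.
    by rewrite (leq_ltn_trans (leq_b1 _)) // ltnS size_poly_gt0.
  rewrite rmorphD rmorphM /= map_polyX map_polyC hornerMXaddC => eE.
  (* [i] is the idempotent cutting out the part where the constant term [a] is invertible. *)
  have [b bE] := vnr a; pose i := f (a * b).
  have fa : f a = i * f a by rewrite -rmorphM mulrAC bE.
  have [|y yE] := ih qm (e * (1 - i)).
    apply: xreg; transitivity (e * ((map_poly f q).[x] * x + f a) * (1 - i) - e * (f a - i * f a)).
      by ring.
    by rewrite eE -fa subrr mulr0 mul0r subr0.
  exists (y - f b * e * (map_poly f q).[x]).
  rewrite mulrBr yE.
  transitivity (e * (1 - i) + e * i - f b * (e * ((map_poly f q).[x] * x + f a))).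
    by rewrite /i rmorphM; ring.
  by rewrite eE mulr0 subr0 -mulrDr subrK mulr1.
by have [y yE] := main p pmon 1 (etrans (mul1r _) px); exists y.
Qed.

(** * Linear disjointness over the constants *)

Section SigmaTriple.
Variable T : sigma_triple.
Local Notation L := (st_L T).
Local Notation sg := (st_sigma T).
Local Notation M := (tensor (st_EL T) (st_EL T)).
Local Notation il := (tensl (st_EL T) (st_EL T)).
Local Notation ir := (tensr (st_EL T) (st_EL T)).
Local Notation FL := (fun c => st_EL T (st_FE T c)).

Lemma st_pr_inj (x y : L) : (forall l, st_pr l x = st_pr l y) -> x = y.
Proof.
move=> h; have [z [_ zu]] := st_product (fun l => st_pr l y).
by rewrite -(zu x h) -(zu y).
Qed.

Lemma st_lift (x : forall l, st_Ll l) : exists y : L, forall l, st_pr l y = x l.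
Proof. by have [y [yE _]] := st_product x; exists y. Qed.

Lemma st_reduced : reduced L.
Proof.
move=> x n xn; apply: st_pr_inj => l; apply/eqP; rewrite rmorph0.
suff : st_pr l x ^+ n == 0 by rewrite expf_eq0 => /andP[].
by rewrite -rmorphXn xn rmorph0.
Qed.

Fact sigma2_comp e : il (sg (st_EL T e)) = ir (sg (st_EL T e)).
Proof. by have [e' ->] := st_sigma_E e; rewrite tens_base. Qed.
(** This is [sigma (x) sigma], well defined because sigma maps E into itself. *)
Definition sigma2 : {rmorphism M -> M} :=
  @tens_lift _ _ _ _ _ _ (il \o sg) (ir \o sg) sigma2_comp.
Lemma sigma2l a : sigma2 (il a) = il (sg a). Proof. exact: tens_liftl. Qed.
Lemma sigma2r a : sigma2 (ir a) = ir (sg a). Proof. exact: tens_liftr. Qed.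

Lemma st_idem (l : 'I_(st_d T)) : {e : L | forall m, st_pr m e = (m == l)%:R}.
Proof. exact/cid/(st_lift (fun m => (m == l)%:R)). Qed.
Definition st_e l := sval (st_idem l).
Lemma st_eE l m : st_pr m (st_e l) = (m == l)%:R.
Proof. exact: (svalP (st_idem l)). Qed.

Lemma st_e_sum : \sum_l st_e l = 1.
Proof.
apply: st_pr_inj => m; rewrite rmorph_sum rmorph1 (bigD1 m) //= st_eE eqxx.
by rewrite big1 ?addr0 // => l; rewrite st_eE eq_sym => /negPf->.
Qed.

(** The images of the idempotents still sum to 1, and each is supported in a single component. *)
Lemma sigma_st_e l : sg (st_e l) = st_e (ordS l).
Proof.
have off k m : m != ordS k -> st_pr m (sg (st_e k)) = 0.
  by apply: st_sigma_L => {}m mk; rewrite st_eE (negPf mk).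
apply: st_pr_inj => m; rewrite st_eE; case: eqVneq => [->|/off//].
rewrite -[RHS](rmorph1 (st_pr (ordS l))) -[in RHS](rmorph1 sg) -st_e_sum.
rewrite !rmorph_sum (bigD1 l) //= big1 ?addr0 // => k kl.
by apply: off; rewrite (inj_eq (@ordS_inj _)) eq_sym.
Qed.

Section Disjoint.
Variables (n : nat) (g : 'I_n -> M).
Hypothesis g_fix : forall i, sigma2 (g i) = g i.

Let relation (S : {set 'I_n}) (a : 'I_n -> L) :=
  \sum_i il (a i) * g i = 0 /\ forall i, i \notin S -> a i = 0.

Let relZ S y a : relation S a -> relation S (fun i => y * a i).
Proof.
move=> [ag aS]; split=> [|i /aS->]; last by rewrite mulr0.
under eq_bigr do rewrite rmorphM -mulrA.
by rewrite -mulr_sumr ag mulr0.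
Qed.

Let relS S a : relation S a -> relation S (fun i => sg (a i)).
Proof.
move=> [ag aS]; split=> [|i /aS->]; last by rewrite rmorph0.
have := congr1 sigma2 ag; rewrite rmorph_sum rmorph0 => {2}<-.
by apply: eq_bigr => i _; rewrite rmorphM sigma2l /= g_fix.
Qed.

Let rel_sum S I (s : seq I) (b : I -> 'I_n -> L) : (forall k, relation S (b k)) ->
  relation S (fun i => \sum_(k <- s) b k i).
Proof.
move=> bS; split=> [|i iS]; last by rewrite big1 // => k _; apply: (bS k).2.
under eq_bigr do rewrite rmorph_sum mulr_suml.
by rewrite exchange_big big1 // => k _; apply: (bS k).1.
Qed.

(** As L is only a product of fields, a nonzero coefficient need not be invertible. It can be scaled
    to one idempotent; sigma carries this idempotent to all the others, and the sum of the resulting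
    relations has coefficient 1. *)
Let rel_normalize S a i : relation S a -> a i != 0 ->
  exists2 b, relation S b & b i = 1.
Proof.
move=> aS /eqP ai0.
have [l al] : exists l, st_pr l (a i) != 0.
  apply: contrapT => no; apply: ai0; apply: st_pr_inj => l; rewrite rmorph0.
  by apply: contrapT => /eqP al; apply: no; exists l.
pose C m := exists2 b, relation S b & b i = st_e m.
have Cl : C l.
  have [y yE] := st_lift (fun m => (st_pr m (a i))^-1).
  exists (fun j => st_e l * y * a j); first exact: relZ.
  apply: st_pr_inj => m; rewrite !rmorphM yE !st_eE -mulrA.
  by case: eqP => [->|_]; rewrite ?mul0r // mulVf ?mulr1.
have CS m : C m -> C (ordS m).
  move=> [b bS bi]; exists (fun j => sg (b j)); first exact: relS.
  by rewrite bi sigma_st_e.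
have CT t : C (iter t (@ordS _) l) by elim: t => //= t; apply: CS.
have Call m : C m.
  (* The number of steps is m - l modulo d, written with [st_d T - l] to avoid truncated
     subtraction. *)
  suff -> : m = iter (m + (st_d T - l)) (@ordS _) l by [].
  have iterE t : iter t (@ordS _) l = ((l + t) %% st_d T)%N :> nat.
    elim: t => [|t ih] /=; first by rewrite addn0 modn_small.
    by rewrite ih -addn1 modnDml addn1 addnS.
  apply: val_inj; rewrite /= iterE addnCA subnKC; last exact: ltnW.
  by rewrite modnDr modn_small.
have [b bP] := choice (fun m => let: ex_intro2 b h1 h2 := Call m in
   ex_intro (fun b => relation S b /\ b i = st_e m) b (conj h1 h2)).
exists (fun j => \sum_(m <- index_enum _) b m j); first by apply: rel_sum => m; case: (bP m).
by rewrite -[RHS]st_e_sum; apply: eq_bigr => m _; case: (bP m).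
Qed.

(* The classical independence argument over constants: normalize one coefficient
   to 1 and subtract the sigma-transform. *)
Let rel_descent S a : relation S a -> (exists i, a i != 0) ->
  exists (la : 'I_n -> st_F T), (exists i, la i != 0) /\ relation S (fun i => FL (la i)).
Proof.
have [k] := ubnP #|S|; elim: k => // k ih in S a * => Sk aS [i ai].
have iS : i \in S by apply: contraNT ai => /aS.2->.
have [b bS bi] := rel_normalize aS ai.
pose c j := sg (b j) - b j.
have cS : relation (S :\ i) c.
  split=> [|j]; last first.
    rewrite !inE negb_and negbK /c => /predU1P[->|jS]; first by rewrite bi rmorph1 subrr.
    by rewrite bS.2 // rmorph0 subrr.
  rewrite /c; under eq_bigr do rewrite rmorphB mulrBl.
  by rewrite sumrB (relS bS).1 bS.1 subrr.
(* A nonzero difference is a relation with smaller support; if it is zero, all coefficients are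
   sigma-invariant and hence lie in F. *)
have [[j cj]|c0] := pselect (exists j, c j != 0).
  have [||la [la0 laS]] := ih _ _ _ cS; last 1 first.
  - exists la; split=> //; split=> [|m mS]; first exact: laS.1.
    by apply: laS.2; rewrite !inE negb_and mS orbT.
  - by rewrite -ltnS (leq_trans _ Sk) // ltnS [in X in (_ < X)%N](cardsD1 i) iS.
  - by exists j.
have bF j : exists c, b j = FL c.
  apply/st_fix_L/eqP; rewrite -subr_eq0; apply/eqP; apply: contrapT => /eqP cj.
  by apply: c0; exists j.
have [la laE] := choice bF; exists la; split.
  exists i; apply/eqP => la0; move/eqP: bi; rewrite laE la0 !rmorph0 eq_sym.
  by rewrite oner_eq0.
by have -> : (fun j => FL (la j)) = b by apply/funext.
Qed.

(** Here [nu] is a candidate specialization of [g] respecting the F-linear relations. Subtracting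
    multiples of F-relations shrinks the support of [a] until nothing is left. *)
Lemma linearly_disjoint (a : 'I_n -> L) (nu : 'I_n -> st_F T) :
  \sum_i il (a i) * g i = 0 ->
  (forall la : 'I_n -> st_F T, \sum_i il (FL (la i)) * g i = 0 -> \sum_i la i * nu i = 0) ->
  \sum_i a i * FL (nu i) = 0.
Proof.
move=> ag nuP; have [k] := ubnP #|[set i | a i != 0]|.
elim: k => // k ih in a ag *; set S := [set _ | _] => Sk.
have aS : relation S a by split=> // i; rewrite inE negbK => /eqP.
have [ex|a0] := pselect (exists i, a i != 0); last first.
  rewrite big1 // => i _; have -> : a i = 0; last by rewrite mul0r.
  by apply: contrapT => /eqP ai; apply: a0; exists i.
have [la [[i li] [lag laS]]] := rel_descent aS ex.
(* The multiple [y] is chosen to cancel the coefficient at [i]; the support of [la] lies in that of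
   [a], so no new coefficient appears. *)
pose y := a i * FL (la i)^-1; pose b j := a j - y * FL (la j).
have yE : y * FL (la i) = a i by rewrite -mulrA -!rmorphM mulVf // !rmorph1 mulr1.
have lanu : \sum_j FL (la j) * FL (nu j) = 0.
  under eq_bigr do rewrite -!rmorphM.
  by rewrite -!rmorph_sum nuP // !rmorph0.
have -> : \sum_j a j * FL (nu j) = \sum_j b j * FL (nu j).
  rewrite /b; under [RHS]eq_bigr do rewrite mulrBl -mulrA.
  by rewrite sumrB -mulr_sumr lanu mulr0 subr0.
apply: ih.
  rewrite /b; under eq_bigr do rewrite rmorphB rmorphM mulrBl -mulrA.
  by rewrite sumrB -mulr_sumr ag lag mulr0 subr0.
have iS : i \in S by apply: contraNT li => /laS /eqP; rewrite !fmorph_eq0.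
apply: leq_trans (_ : #|S| <= k)%N; last by rewrite -ltnS.
rewrite (cardsD1 i S) iS ltnS; apply/subset_leq_card/fintype.subsetP => j; rewrite !inE => bj.
apply/andP; split; first by apply: contraNneq bj => ->; rewrite /b yE subrr.
by apply: contraNN bj => /eqP aj; rewrite /b aj laS ?mulr0 ?subrr // inE aj eqxx.
Qed.
End Disjoint.

End SigmaTriple.

(** * The ring of fractions and its base change *)

Section Swap.
Variables (K : fieldType) (A B : comNzRingType).
Variables (f : {rmorphism K -> A}) (g : {rmorphism K -> B}).

Fact tens_swap_comp k : tensr g f (f k) = tensl g f (g k).
Proof. by rewrite tens_base. Qed.
Definition tens_swap : {rmorphism tensor f g -> tensor g f} :=
  @tens_lift _ _ _ f g _ (tensr g f) (tensl g f) tens_swap_comp.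
Lemma tens_swapl a : tens_swap (tensl f g a) = tensr g f a.
Proof. exact: tens_liftl. Qed.
Lemma tens_swapr b : tens_swap (tensr f g b) = tensl g f b.
Proof. exact: tens_liftr. Qed.
End Swap.

Lemma tens_swapK (K : fieldType) (A B : comNzRingType)
    (f : {rmorphism K -> A}) (g : {rmorphism K -> B}) :
  cancel (tens_swap f g) (tens_swap g f).
Proof.
apply: (tensor_rmorph_ext (u := tens_swap g f \o tens_swap f g) (v := idfun)).
  by move=> a /=; rewrite tens_swapl tens_swapr.
by move=> b /=; rewrite tens_swapr tens_swapl.
Qed.

Lemma reduced_swap (K : fieldType) (A B : comNzRingType)
    (f : {rmorphism K -> A}) (g : {rmorphism K -> B}) :
  reduced (tensor f g) -> reduced (tensor g f).
Proof.
move=> red x n xn; rewrite -[x]tens_swapK (red (tens_swap g f x) n) ?rmorph0 //.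
by rewrite -rmorphXn xn rmorph0.
Qed.

(* A reduced ring embeds into a product of fields, so separability, which is
   defined by field extensions, controls all reduced base changes. *)
Lemma separable_reduced (K : fieldType) (A R : comNzRingType)
    (f : {rmorphism K -> A}) (g : {rmorphism K -> R}) :
  separable_algebra f -> reduced R -> reduced (tensor f g).
Proof.
move=> sep red w n wn; apply: contract_separates => phi phiL.
apply: contrapT => /eqP c0.
have [F [h hc]] : exists (F : fieldType) (h : {rmorphism R -> F}), h (contract phi w) != 0.
  by apply: not_nilpotent_field => m; apply: contra_neq c0 => /red.
move/eqP: hc; apply.
have w0 : tens_mapr f (v := h) (h := h \o g) (fun=> erefl) w = 0.
  by apply: (sep F (h \o g) _ n); rewrite -rmorphXn wn rmorph0.
by rewrite -(contract_mapr (h := h \o g) (fun=> erefl) w phiL) w0 contract0.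
Qed.

Section LambdaTheory.
Variables (T : sigma_triple) (r : nat).
Variables (Phi : 'M[st_E T]_r) (Psi : 'M[st_L T]_r).
Hypothesis Psi_unit : Psi \in unitmx.
Hypothesis Psi_eq : map_mx (st_sigma T) Psi = map_mx (st_EL T) Phi *m Psi.
Local Notation La := (Lambda_ring Psi).
Local Notation Sig := (Sigma (st_EL T) Psi).

Fact Lambda_val_is_zmod_morphism : zmod_morphism (fun x : La => Lambda_val x).
Proof. by []. Qed.
Fact Lambda_val_is_monoid_morphism : monoid_morphism (fun x : La => Lambda_val x).
Proof. by []. Qed.
Definition Lambda_incl : {rmorphism La -> st_L T} := HB.pack_for {rmorphism La -> st_L T}
  (fun x : La => Lambda_val x)
  (GRing.isZmodMorphism.Build _ _ _ Lambda_val_is_zmod_morphism)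
  (GRing.isMonoidMorphism.Build _ _ _ Lambda_val_is_monoid_morphism).

Lemma Lambda_incl_inj : injective Lambda_incl.
Proof. exact: val_inj. Qed.

Lemma Lambda_reduced : reduced La.
Proof.
move=> x n xn; apply: Lambda_incl_inj; apply: (@st_reduced _ _ n).
by rewrite -rmorphXn xn rmorph0.
Qed.

(** Clearing a denominator [s] gives a regular element [s * x] of Sigma, which is a unit of L; the
    inverse [s / (s * x)] is again a fraction. *)
Lemma Lambda_regular_unit (x : La) : (forall y, x * y = 0 -> y = 0) -> exists y, x * y = 1.
Proof.
case: x => x Lx xreg; have /asboolP[s [Ss sreg] Sx] := Lx.
have areg : Sigma_regular (st_EL T) Psi (s * x).
  split=> // t St sxt; apply: sreg => //.
  have Lst : s * t \in Lambda (st_EL T) Psi by apply: Sigma_Lambda; apply: rpredM.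
  suff : MkLambda Lst = 0 :> La by move/(congr1 Lambda_incl).
  by apply: xreg; apply: Lambda_incl_inj; rewrite rmorphM rmorph0 -[RHS]sxt mulrA [s * x]mulrC.
have au := Sigma_regular_unit Psi_unit Psi_eq areg.
have Ly : s * (s * x)^-1 \in Lambda (st_EL T) Psi.
  by apply/asboolP; exists (s * x) => //; rewrite mulrC mulrVK.
exists (MkLambda Ly); apply: Lambda_incl_inj; rewrite rmorphM rmorph1.
by rewrite mulrA [x * s]mulrC /= mulrV.
Qed.

(* If b annihilates a and has the largest possible support, then a + b is regular. *)
Lemma Lambda_von_neumann_regular (a : La) : exists b, a * a * b = a.
Proof.
pose supp (b : La) := [set l | st_pr l (Lambda_incl b) != 0].
pose P n := `[< exists b, a * b = 0 /\ #|supp b| = n >].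
have exP : exists n, P n by exists #|supp 0|; apply/asboolP; exists 0; rewrite mulr0.
have ubP n : P n -> (n <= st_d T)%N.
  by move=> /asboolP[b [_ <-]]; rewrite -[leqRHS]card_ord max_card.
case: (ex_maxnP exP ubP) => n /asboolP[b [ab bn]] nmax.
have [c abc] : exists c, (a + b) * c = 1.
  (* As the ring is reduced, a nonzero [c] killed by [a + b] is killed by both [a] and [b]; then
     [b + c] annihilates [a] and has larger support than [b]. *)
  apply: Lambda_regular_unit => c abc0; apply: contrapT => /eqP c0.
  have ac : a * c = 0.
    apply: (@Lambda_reduced _ 2); rewrite expr2.
    transitivity (c * (a * ((a + b) * c) - (a * b) * c)); first by ring.
    by rewrite abc0 ab mul0r mulr0 subr0 mulr0.
  have bc : b * c = 0 by rewrite -abc0 mulrDl ac add0r.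
  have [l cl] : exists l, st_pr l (Lambda_incl c) != 0.
    apply: contrapT => no; move/eqP: c0; apply; apply: Lambda_incl_inj; apply: st_pr_inj => l.
    by rewrite !rmorph0; apply: contrapT => /eqP cl; apply: no; exists l.
  have disj m : st_pr m (Lambda_incl b) = 0 \/ st_pr m (Lambda_incl c) = 0.
    have /eqP : st_pr m (Lambda_incl (b * c)) = 0 by rewrite bc !rmorph0.
    by rewrite !rmorphM mulf_eq0 => /orP[/eqP|/eqP]; [left|right].
  have /nmax : P #|supp (b + c)|.
    by apply/asboolP; exists (b + c); rewrite mulrDr ab ac addr0.
  rewrite leqNgt -bn => /negP; apply.
  apply/proper_card/properP; split; last first.
    exists l; rewrite !inE.
      by case: (disj l) cl => [bl|->]; rewrite ?eqxx // !rmorphD bl add0r.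
    by case: (disj l) cl => ->; rewrite eqxx.
  apply/fintype.subsetP => m; rewrite !inE !rmorphD.
  by case: (disj m) => ->; rewrite ?eqxx // addr0.
exists c; transitivity (a * ((a + b) * c) - (a * b) * c); first by ring.
by rewrite abc ab mul0r mulr1 subr0.
Qed.

Lemma gl_eval_rmorph (K : fieldType) (R S : comNzRingType) (psi : {rmorphism R -> S})
    (f : K -> R) (f' : K -> S) (M : 'M[R]_r) y (M' : 'M[S]_r) y' h :
  (forall c, psi (f c) = f' c) -> map_mx psi M = M' -> psi y = y' ->
  psi (gl_eval f M y h) = gl_eval f' M' y' h.
Proof.
move=> ff' <- <-; rewrite /gl_eval rmorph_mmap; apply: eq_mmap => // k.
exact: gl_pt_map.
Qed.

(** Regular elements of Sigma are units of L, so their projections are nonzero and fractions project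
    to fractions. *)
Lemma exists_Lambda_pr l : exists h : {rmorphism La -> Lambda_l_ring Psi l},
  forall x, Lambda_val (h x) = st_pr l (Lambda_incl x).
Proof.
have dE : st_pr l (\det Psi)^-1 = (\det (map_mx (st_pr l) Psi))^-1.
  by rewrite det_map_mx rmorphV // -unitmxE.
have SS x : x \in Sig -> st_pr l x \in Sigma (st_El l) (map_mx (st_pr l) Psi).
  by case/asboolP => h ->; apply/asboolP; exists h; apply: gl_eval_rmorph.
have LL x : x \in Lambda (st_EL T) Psi ->
    st_pr l x \in Lambda (st_El l) (map_mx (st_pr l) Psi).
  case/asboolP => s sreg Sx; apply/asboolP; exists (st_pr l s); last first.
    by rewrite -rmorphM; apply: SS.
  split=> [|a _ /eqP]; first exact/SS/sreg.1.
  have : st_pr l s \is a GRing.unit.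
    exact/rmorph_unit/(Sigma_regular_unit Psi_unit Psi_eq sreg).
  by rewrite mulf_eq0 unitfE => /negPf-> /eqP.
pose h (x : La) : Lambda_l_ring Psi l := MkLambda (LL _ (LambdaP x)).
have hB : zmod_morphism h by move=> x y; apply: val_inj; rewrite /= rmorphB.
have hM : monoid_morphism h.
  by split=> [|x y]; apply: val_inj; rewrite /= ?rmorph1 ?rmorphM.
by exists (HB.pack_for {rmorphism La -> Lambda_l_ring Psi l} h
  (GRing.isZmodMorphism.Build _ _ _ hB) (GRing.isMonoidMorphism.Build _ _ _ hM)).
Qed.

(** * Reducedness and units of Lambda' *)

Section BaseChange.
Variables (F' : fieldType) (iF' : {rmorphism st_F T -> F'}).
Local Notation La' := (Lambda' Psi iF').
Local Notation tl := (tensl iF' (F_Lambda Psi)).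
Local Notation tr := (tensr iF' (F_Lambda Psi)).

(** If F' = F, every element comes from the reduced ring Lambda. Otherwise contractions and the
    projections to the Lambda_l reduce the claim to the rings F' (x) Lambda_l, which are reduced by
    separability. *)
Lemma Lambda'_reduced :
  (forall x : F', exists c, x = iF' c) \/
    (forall l, regular_extension (F_Lambda_l Psi l)) ->
  reduced La'.
Proof.
case=> [surj|reg] z n zn.
  have [x zE] : exists x, z = tr x.
    rewrite (tensor_sum z); apply: (big_ind (fun z => exists x, z = tr x)).
    - by exists 0; rewrite rmorph0.
    - by move=> _ _ [x ->] [y ->]; exists (x + y); rewrite rmorphD.
    - move=> p _; have [c ->] := surj p.1.
      by exists (F_Lambda Psi c * p.2); rewrite tens_base rmorphM.
  rewrite zE (@Lambda_reduced x n) ?rmorph0 //.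
  by apply: (@tensr_inj _ _ _ iF' (F_Lambda Psi)); rewrite rmorph0 -zn zE; apply: rmorphXn.
apply: contract_separates => phi phiL; apply: Lambda_incl_inj.
apply: st_pr_inj => l; rewrite !rmorph0.
have [h hE] := exists_Lambda_pr l.
have hF k : h (F_Lambda Psi k) = F_Lambda_l Psi l k.
  by apply: val_inj; rewrite /= hE.
rewrite -hE -(contract_mapr hF z phiL).
have := reduced_swap ((reg l).1 F' iF') => /(_ (tens_mapr iF' hF z) n) ->.
  by rewrite contract0.
by rewrite -rmorphXn zn rmorph0.
Qed.

(** Lambda' is integral over Lambda: on a pure tensor, the left factor satisfies a monic equation
    over F and the right factor lies in Lambda. *)
Lemma Lambda'_regular_unit (F'_alg : forall x : F', algebraicOver iF' x) (x : La') :
  (forall y, x * y = 0 -> y = 0) -> exists y, x * y = 1.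
Proof.
move=> xreg.
apply: (integral_regular_unit (f := tr) Lambda_von_neumann_regular xreg).
rewrite (tensor_sum x); apply: (big_ind (integralOver tr)).
- exact: integral0.
- by move=> u v; apply: integral_add.
- move=> p _; apply: integral_mul; last exact: integral_id.
  have /integral_algebraic[q qmon /eqP q0] := F'_alg p.1.
  exists (map_poly (F_Lambda Psi) q); first exact: monic_map.
  apply/eqP; rewrite -map_poly_comp.
  have -> : map_poly (tr \o F_Lambda Psi) q = map_poly tl (map_poly iF' q).
    by rewrite -map_poly_comp; apply: eq_map_poly => k /=; rewrite tens_base.
  by rewrite horner_map q0 rmorph0.
Qed.
End BaseChange.
End LambdaTheory.

(** * Evaluation at Psi and translation by gamma *)

Section Evaluation.
Variables (T : sigma_triple) (r : nat) (Psi : 'M[st_L T]_r).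
Hypothesis Psi_unit : Psi \in unitmx.
Local Notation E := (st_E T).
Local Notation L := (st_L T).
Local Notation La := (Lambda_ring Psi).
Local Notation Pol := {mpoly E[r * r + 1]}.
Local Notation cst := (LambdaC (st_EL T) Psi).
Local Notation PsiL := (LambdaM (st_EL T) Psi).
Local Notation incl := (Lambda_incl Psi).

Fact det_inv_Lambda : (\det Psi)^-1 \in Lambda (st_EL T) Psi.
Proof.
apply/Sigma_Lambda/asboolP; exists (gl_Y r E).
by rewrite /gl_eval mmap_gl_Y.
Qed.
Definition Psi_det_inv : La := MkLambda det_inv_Lambda.

Lemma incl_PsiL : map_mx incl PsiL = Psi.
Proof. by apply/matrixP => i j; rewrite !mxE. Qed.

Lemma det_PsiL : \det PsiL * Psi_det_inv = 1.
Proof.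
apply: Lambda_incl_inj; rewrite rmorphM rmorph1 -det_map_mx incl_PsiL /=.
by rewrite mulrV // -unitmxE.
Qed.

Section Ev.
Variables (C : comNzRingType) (c : {rmorphism La -> C}) (N : 'M[C]_r) (y : C).

(* h |-> h(Psi N), where y has to be the inverse of det N *)
Definition ev : {rmorphism Pol -> C} :=
  mmap (c \o cst) (gl_pt (map_mx c PsiL *m N) (c Psi_det_inv * y)).

Lemma evC e : ev e%:MP = c (cst e).
Proof. exact: mmapC. Qed.

Lemma ev_X : map_mx ev (gl_X r E) = map_mx c PsiL *m N.
Proof. exact: mmap_gl_X. Qed.

Lemma ev_Y : ev (gl_Y r E) = c Psi_det_inv * y.
Proof. exact: mmap_gl_Y. Qed.

End Ev.

Lemma ev_rmorph (C D : comNzRingType) (psi : {rmorphism C -> D})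
    (c : {rmorphism La -> C}) N y (c' : {rmorphism La -> D}) N' y' h :
  (forall e, psi (c (cst e)) = c' (cst e)) ->
  map_mx psi (map_mx c PsiL *m N) = map_mx c' PsiL *m N' ->
  psi (c Psi_det_inv * y) = c' Psi_det_inv * y' ->
  psi (ev c N y h) = ev c' N' y' h.
Proof.
move=> cc' NN' yy'; rewrite /ev /= rmorph_mmap; apply: eq_mmap => [e|k] /=.
  exact: cc'.
by rewrite gl_pt_map NN' yy'.
Qed.

Definition ev1 : {rmorphism Pol -> La} := ev idfun 1%:M 1.

Lemma rmorph_ev1 (D : comNzRingType) (c : {rmorphism La -> D})
    (c' : {rmorphism La -> D}) N' y' h :
  (forall e, c (cst e) = c' (cst e)) ->
  map_mx c PsiL = map_mx c' PsiL *m N' ->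
  c Psi_det_inv = c' Psi_det_inv * y' ->
  c (ev1 h) = ev c' N' y' h.
Proof.
move=> cc' NN' yy'; apply: ev_rmorph => //.
  by rewrite mulmx1 map_mx_id.
by rewrite mulr1.
Qed.

Lemma ev1E h : incl (ev1 h) = gl_eval (st_EL T) Psi (\det Psi)^-1 h.
Proof.
rewrite [LHS](rmorph_mmap incl); apply: eq_mmap => // k.
by rewrite gl_pt_map mulmx1 map_mx_id // incl_PsiL mulr1.
Qed.

(** [Q] is h(Psi X) as a polynomial over Lambda, obtained by evaluating at the generic point. *)
Lemma universal_polynomial (h : Pol) :
  exists Q : {mpoly La[r * r + 1]},
    forall (C : comNzRingType) (c : {rmorphism La -> C}) N y,
      mmap c (gl_pt N y) Q = ev c N y h.
Proof.
pose MP : comNzRingType := {mpoly La[r * r + 1]}.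
pose mC : {rmorphism La -> MP} := @mpolyC (r * r + 1) La.
exists (ev mC (gl_X r La) (gl_Y r La) h) => C c N y.
pose U : {rmorphism MP -> C} := mmap c (gl_pt N y).
have UC x : U (mC x) = c x by exact: mmapC.
apply: (ev_rmorph (psi := U)) => [e||]; first exact: UC.
  rewrite map_mxM (mmap_gl_X c N y); congr (_ *m _).
  by apply/matrixP => i j; rewrite !mxE; apply: UC.
by rewrite rmorphM UC; congr (_ * _); apply: (mmap_gl_Y c N y).
Qed.

(** * Evaluation and translation over F' *)

Section BaseChange.
Variables (F' : fieldType) (iF' : {rmorphism st_F T -> F'}).
Local Notation La' := (Lambda' Psi iF').
Local Notation tl := (tensl iF' (F_Lambda Psi)).
Local Notation tr := (tensr iF' (F_Lambda Psi)).

Definition F_Pol : {rmorphism st_F T -> Pol} := @mpolyC _ E \o st_FE T.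
(** This is E'[X, Y], in the presentation where Y stands for 1 / det X. *)
Definition Pol' := tensor iF' F_Pol.
Local Notation pl := (tensl iF' F_Pol).
Local Notation pr := (tensr iF' F_Pol).

Section Ev'.
Variables (C : comNzRingType) (c : {rmorphism La' -> C}) (N : 'M[C]_r) (y : C).

Fact ev'_comp k : (c \o tl) (iF' k) = ev (c \o tr) N y (F_Pol k).
Proof. by rewrite evC /= tens_base. Qed.
Definition ev' : {rmorphism Pol' -> C} := tens_lift ev'_comp.

Lemma ev'l a : ev' (pl a) = c (tl a). Proof. exact: tens_liftl. Qed.
Lemma ev'r h : ev' (pr h) = ev (c \o tr) N y h. Proof. exact: tens_liftr. Qed.
End Ev'.

Lemma ev'_rmorph (C D : comNzRingType) (psi : {rmorphism C -> D})
    (c : {rmorphism La' -> C}) N y (c' : {rmorphism La' -> D}) N' y' w :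
  (forall a, psi (c (tl a)) = c' (tl a)) ->
  (forall e, psi (c (tr (cst e))) = c' (tr (cst e))) ->
  map_mx psi (map_mx c (map_mx tr PsiL) *m N) = map_mx c' (map_mx tr PsiL) *m N' ->
  psi (c (tr Psi_det_inv) * y) = c' (tr Psi_det_inv) * y' ->
  psi (ev' c N y w) = ev' c' N' y' w.
Proof.
move=> ccl ccr NN yy; apply: (tensor_rmorph_ext (u := psi \o ev' c N y)) => [a|h] /=.
  by rewrite !ev'l.
rewrite !ev'r; apply: ev_rmorph => //.
have compE (B : comNzRingType) (k : {rmorphism La' -> B}) :
    map_mx (k \o tr) PsiL = map_mx k (map_mx tr PsiL).
  by apply/matrixP => i j; rewrite !mxE.
by rewrite !compE.
Qed.

Definition ev1' : {rmorphism Pol' -> La'} := ev' idfun 1%:M 1.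

Lemma ev1'l a : ev1' (pl a) = tl a. Proof. exact: ev'l. Qed.
Lemma ev1'r h : ev1' (pr h) = tr (ev1 h).
Proof.
rewrite [LHS]ev'r; apply/esym/rmorph_ev1 => //.
  by rewrite mulmx1; apply/matrixP => i j; rewrite !mxE.
by rewrite mulr1.
Qed.

Lemma rmorph_ev1' (D : comNzRingType) (c c' : {rmorphism La' -> D}) N' y' w :
  (forall a, c (tl a) = c' (tl a)) ->
  (forall e, c (tr (cst e)) = c' (tr (cst e))) ->
  map_mx c (map_mx tr PsiL) = map_mx c' (map_mx tr PsiL) *m N' ->
  c (tr Psi_det_inv) = c' (tr Psi_det_inv) * y' ->
  c (ev1' w) = ev' c' N' y' w.
Proof.
move=> ccl ccr NN yy; apply: ev'_rmorph => //.
  by rewrite mulmx1 map_mx_id.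
by rewrite mulr1.
Qed.

(** The substitution h |-> h(Psi gamma), that is, the action of gamma before passing to the quotient
    and to fractions. *)
Definition evg (gamma : 'M[F']_r) : {rmorphism Pol' -> La'} :=
  ev' idfun (map_mx tl gamma) (tl (\det gamma)^-1).

Lemma evgr gamma h :
  evg gamma (pr h) = ev tr (map_mx tl gamma) (tl (\det gamma)^-1) h.
Proof.
by rewrite [LHS]ev'r; apply: eq_mmap.
Qed.

(* h(X) |-> h(X gamma) *)
Section Translate.
Variable gamma : 'M[F']_r.

Let trans : {rmorphism Pol -> Pol'} :=
  mmap (pr \o @mpolyC _ E)
    (gl_pt (map_mx pr (gl_X r E) *m map_mx pl gamma) (pr (gl_Y r E) * pl (\det gamma)^-1)).

Fact translate_comp k : pl (iF' k) = trans (F_Pol k).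
Proof. by rewrite /trans /= mmapC /= -tens_base. Qed.
Definition translate : {rmorphism Pol' -> Pol'} := tens_lift translate_comp.

Lemma ev'_translate (C : comNzRingType) (c : {rmorphism La' -> C}) N y w :
  ev' c N y (translate w) =
  ev' c (N *m map_mx c (map_mx tl gamma)) (y * c (tl (\det gamma)^-1)) w.
Proof.
apply: (tensor_rmorph_ext (u := ev' c N y \o translate)) => [a|h] /=.
  by rewrite tens_liftl !ev'l.
rewrite tens_liftr ev'r /trans rmorph_mmap; apply: eq_mmap => [e|k] /=.
  by rewrite ev'r evC.
rewrite gl_pt_map map_mxM rmorphM !ev'l ev'r ev_Y /= mulrA.
congr (gl_pt _ _ k); rewrite mulmxA; congr (_ *m _).
  apply/matrixP => i j; rewrite -(ev_X (c \o tr) N y) !mxE.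
  by rewrite ev'r.
by apply/matrixP => i j; rewrite !mxE ev'l.
Qed.
End Translate.

End BaseChange.
End Evaluation.

(** * The Galois correspondence *)

Section Galois.
Variables (T : sigma_triple) (r : nat).
Variables (Phi : 'M[st_E T]_r) (Psi : 'M[st_L T]_r).
Hypothesis Psi_unit : Psi \in unitmx.
Hypothesis Psi_eq : map_mx (st_sigma T) Psi = map_mx (st_EL T) Phi *m Psi.
Local Notation E := (st_E T).
Local Notation L := (st_L T).
Local Notation La := (Lambda_ring Psi).
Local Notation Pol := {mpoly E[r * r + 1]}.
Local Notation cst := (LambdaC (st_EL T) Psi).
Local Notation PsiL := (LambdaM (st_EL T) Psi).
Local Notation incl := (Lambda_incl Psi).
Local Notation ev1 := (ev1 Psi).
Local Notation Psi_det_inv := (Psi_det_inv Psi).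
Variables (F' : fieldType) (iF' : {rmorphism st_F T -> F'}).
Local Notation La' := (Lambda' Psi iF').
Local Notation tl := (tensl iF' (F_Lambda Psi)).
Local Notation tr := (tensr iF' (F_Lambda Psi)).
Local Notation Pol' := (Pol' r iF').
Local Notation pl := (tensl iF' (F_Pol T r)).
Local Notation pr := (tensr iF' (F_Pol T r)).
Local Notation ev1' := (ev1' Psi iF').
Local Notation evg := (evg Psi iF').

Lemma Lambda_fraction (x : La) : exists k h c, ev1 k * x = ev1 h /\ ev1 k * c = 1.
Proof.
have /asboolP[s sreg /asboolP[h hE]] := LambdaP x.
have su := Sigma_regular_unit Psi_unit Psi_eq sreg.
have /asboolP[k kE] := sreg.1.
have Lc : s^-1 \in Lambda (st_EL T) Psi.
  by apply/asboolP; exists s => //; rewrite mulrV ?rpred1.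
exists k, h, (MkLambda Lc); split; apply: Lambda_incl_inj.
  by rewrite rmorphM !ev1E // -kE -hE.
by rewrite rmorphM ev1E // -kE /= mulrV ?rmorph1.
Qed.

(** Denominators can be taken in Sigma: those of the right factors of finitely many pure tensors are
    multiplied together. *)
Lemma Lambda'_fraction (z : La') : exists k h c,
  tr (ev1 k) * z = ev1' h /\ ev1 k * c = 1.
Proof.
rewrite (tensor_sum z); apply: (big_ind (fun z => exists k h c,
  tr (ev1 k) * z = ev1' h /\ ev1 k * c = 1)).
- by exists 1, 0, 1; rewrite mulr0 !rmorph0 !rmorph1 mul1r.
- move=> u v [k [h [c [kh kc]]]] [k' [h' [c' [kh' kc']]]].
  exists (k * k'), (pr k' * h + pr k * h'), (c * c'); split; last first.
    by rewrite rmorphM mulrACA kc kc' mulr1.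
  by rewrite !rmorphD !rmorphM /= !ev1'r -kh -kh'; ring.
- move=> p _; have [k [h [c [kh kc]]]] := Lambda_fraction p.2.
  exists k, (pl p.1 * pr h), c; split=> //.
  by rewrite rmorphM ev1'l ev1'r -kh rmorphM /= mulrCA.
Qed.

(** The action prescribes only the constants and Psi; the image of 1 / det Psi is then forced by
    multiplicativity of the determinant. *)
Lemma extends_action_ev gamma alpha w : gamma \in unitmx -> extends_action gamma alpha ->
  alpha (ev1' w) = evg gamma w.
Proof.
move=> gu [alphaC alphaM]; have detE : tr (\det PsiL) * tr Psi_det_inv = 1.
  by rewrite -rmorphM det_PsiL // rmorph1.
apply: rmorph_ev1' => [a|e||] /=.
- by have := alphaC a 1; rewrite rmorph1.
- exact: alphaC 1 e.
- by rewrite [LHS]alphaM map_mx_id.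
have /(congr1 alpha) := detE; rewrite rmorphM rmorph1 /=.
have -> : alpha (tr (\det PsiL)) = tr (\det PsiL) * tl (\det gamma).
  by rewrite -!det_map_mx alphaM det_mulmx.
have gE : tl (\det gamma) * tl (\det gamma)^-1 = 1.
  by rewrite -rmorphM mulrV -?unitmxE // rmorph1.
move=> aE; transitivity (tr (\det PsiL) * tr Psi_det_inv * (tl (\det gamma) * tl (\det gamma)^-1)
    * alpha (tr Psi_det_inv)); first by rewrite detE gE !mul1r.
transitivity (tr (\det PsiL) * tl (\det gamma) * alpha (tr Psi_det_inv)
    * (tr Psi_det_inv * tl (\det gamma)^-1)).
  by ring.
by rewrite aE mul1r.
Qed.

Lemma universal_difference (a b : La') (v w : Pol') :
  exists Q : {mpoly La'[r * r + 1]},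
    forall (C : comNzRingType) (u : {rmorphism La' -> C}) N y,
      mmap u (gl_pt N y) Q = u a * ev' u N y v - u b * ev' u N y w.
Proof.
pose MP : comNzRingType := {mpoly La'[r * r + 1]}.
pose mC : {rmorphism La' -> MP} := @mpolyC (r * r + 1) La'.
pose evX : {rmorphism Pol' -> MP} := ev' mC (gl_X r La') (gl_Y r La').
exists (mC a * evX v - mC b * evX w) => C u N y.
pose U : {rmorphism MP -> C} := mmap u (gl_pt N y).
have UC x : U (mC x) = u x by exact: mmapC.
have UevX x : U (evX x) = ev' u N y x.
  apply: ev'_rmorph => [c|e||].
  - exact: UC.
  - exact: UC.
  - rewrite map_mxM (mmap_gl_X u N y); congr (_ *m _).
    by apply/matrixP => i j; rewrite !mxE; apply: UC.
  by rewrite rmorphM UC; congr (_ * _); apply: (mmap_gl_Y u N y).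
have Usub (a1 b1 a2 b2 : MP) : U (a1 * b1 - a2 * b2) = U a1 * U b1 - U a2 * U b2.
  by rewrite rmorphB !rmorphM.
by rewrite [LHS]Usub !UC !UevX.
Qed.

(** * Elements fixed by Gamma(F') lie in E' *)

Section Fixed.
Hypothesis La'_red : reduced La'.
Hypothesis dense : Gamma_dense Psi iF'.

Let iE : {rmorphism E -> La'} := tr \o cst.
Local Notation W := (tensor (st_EL T) iE).
Local Notation jl := (tensl (st_EL T) iE).
Local Notation jr := (tensr (st_EL T) iE).

Let j1_comp k : (jr \o tl) (iF' k) = (jl \o incl) (F_Lambda Psi k).
Proof. by rewrite /= tens_base -[RHS]/(jl (st_EL T (st_FE T k))) tens_base. Qed.
(* c (x) x |-> x (x) (c (x) 1) in L (x)_E Lambda' *)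
Let j1 : {rmorphism La' -> W} := tens_lift j1_comp.

(** [GW] and [gW] are G and its inverse determinant with the second factor taken in Lambda'. *)
Let GW : 'M[W]_r := map_mx jl (invmx Psi) *m map_mx jr (map_mx tr PsiL).
Let gW : W := jl (\det Psi) * jr (tr Psi_det_inv).

(** The ideal q is defined in L (x)_E L. Since L (x)_E Lambda embeds there, its relations already
    hold over Lambda, from where they are pushed to Lambda'. *)
Let Gamma_ideal_W h : Gamma_ideal Psi h ->
  mmap (fun c => jr (tl (iF' c))) (gl_pt GW gW) h = 0.
Proof.
move=> qh; pose V := tensor (st_EL T) cst.
pose vl := tensl (st_EL T) cst; pose vr := tensr (st_EL T) cst.
have inclE e : incl (cst e) = st_EL T e by [].
pose GV := map_mx vl (invmx Psi) *m map_mx vr PsiL.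
pose gV := vl (\det Psi) * vr Psi_det_inv.
have V0 : gl_eval (fun c => vl (st_EL T (st_FE T c))) GV gV h = 0.
  apply: (@tens_mapr_inj _ _ _ _ (st_EL T) cst (st_EL T) incl inclE).
    exact: Lambda_incl_inj.
  rewrite rmorph0 -[RHS]qh; apply: gl_eval_rmorph => [c||].
  - exact: tens_maprl.
  - rewrite map_mxM; congr (_ *m _); apply/matrixP => i j; rewrite !mxE.
      exact: tens_maprl.
    exact: tens_maprr.
  by rewrite rmorphM; congr (_ * _); [exact: tens_maprl | exact: tens_maprr].
have trE e : tr (cst e) = iE e by [].
have := congr1 (tens_mapr (st_EL T) trE) V0; rewrite rmorph0 => <-.
apply/esym; apply: gl_eval_rmorph => [c||].
- apply: etrans (tens_maprl _ trE _) _; rewrite tens_base.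
  by rewrite -[RHS]/(jr (tl (iF' c))) tens_base.
- rewrite map_mxM; congr (_ *m _); apply/matrixP => i j; rewrite !mxE.
    exact: tens_maprl.
  exact: tens_maprr.
by rewrite rmorphM; congr (_ * _); [exact: tens_maprl | exact: tens_maprr].
Qed.

(** A nonzero value in the reduced ring [W] survives in some field. The polynomials vanishing there
    form a prime containing q, which by density contains [H]. *)
Let dense_W (H : {mpoly F'[r * r + 1]}) :
  (forall gamma, Gamma_point Psi iF' gamma -> gl_eval id gamma (\det gamma)^-1 H = 0) ->
  mmap (fun c => jr (tl c)) (gl_pt GW gW) H = 0.
Proof.
move=> Hpt; apply: contrapT => /eqP w0; set w := mmap _ _ _ in w0.
have W_red : reduced W := separable_reduced (@st_separable T) La'_red.
have [K [psi /negP psiw]] : exists (K : fieldType) (psi : {rmorphism W -> K}), psi w != 0.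
  by apply: not_nilpotent_field => n; apply: contra_neq w0 => /W_red.
apply: psiw; pose theta : {rmorphism {mpoly F'[r * r + 1]} -> K} :=
  psi \o (mmap (jr \o tl) (gl_pt GW gW) : {rmorphism _ -> _}).
pose P : {pred {mpoly F'[r * r + 1]}} := [pred h | theta h == 0].
suff : H \in P by [].
apply: (dense (I := pred1 H) _ (P := P)); last by rewrite inE.
- by move=> gamma gP h /eqP->; apply: Hpt.
- split=> [||a u v]; rewrite !inE ?rmorph0 ?rmorph1 ?oner_eq0 //.
  by move=> /eqP u0 /eqP v0; rewrite rmorphD rmorphM u0 v0 mulr0 addr0.
- by move=> u v; rewrite !inE rmorphM mulf_eq0.
- move=> h /Gamma_ideal_W h0; rewrite inE /theta /=.
  suff -> : mmap (jr \o tl) (gl_pt GW gW) (map_mpoly iF' h) = 0 by rewrite rmorph0.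
  pose nu : {rmorphism {mpoly F'[r * r + 1]} -> W} := mmap (jr \o tl) (gl_pt GW gW).
  rewrite -[RHS]h0 [LHS](rmorph_mmap nu); apply: eq_mmap => [c|k].
    by rewrite /nu /= mmapC.
  by rewrite /nu /= mmapX mmap1U.
Qed.

Lemma Gamma_fixed_E' (z : La') : Gamma_fixed z -> in_E' z.
Proof.
move=> zfix; have [k [h [c [kz kc]]]] := Lambda'_fraction z.
(* For z = b / s with s = k(Psi) and b = h(Psi), [Q] is s h(Psi X) - b k(Psi X). *)
have [Q QE] := universal_difference (tr (ev1 k)) (ev1' h) h (pr k).
have [m [a [H [QH Hpt]]]] := mpoly_frame tl Q.
have H0 i : mmap (fun c => jr (tl c)) (gl_pt GW gW) (H i) = 0.
  (* As z is fixed, h(Psi gamma) = k(Psi gamma) z, so [Q] vanishes at gamma; [H i] takes there a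
     linear form of this value. *)
  apply: dense_W => gamma gP; have [phi phiL HE] := Hpt i.
  rewrite [LHS]HE; have -> : mmap id (fun k => tl (gl_pt gamma (\det gamma)^-1 k)) Q = 0.
    rewrite (eq_mmap (f' := id) (p' := gl_pt (map_mx tl gamma) (tl (\det gamma)^-1))) //.
      have [alpha ext az] := zfix gamma gP.
      have aE w := extends_action_ev w gP.1 ext.
      have e2 : evg gamma (pr k) * z = evg gamma h.
        apply: etrans (aE h); rewrite -(aE (pr k)) -kz ev1'r.
        by apply: esym; apply: etrans (rmorphM alpha _ _) _; rewrite az.
      have e3 (x y t : La') : x * (y * t) - (x * t) * y = 0 by ring.
      have e4 := QE _ idfun (map_mx tl gamma) (tl (\det gamma)^-1).
      apply: etrans e4 _.
      have e5 : tr (ev1 k) * evg gamma h - ev1' h * evg gamma (pr k) = 0.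
        by rewrite -e2 -kz; exact: e3.
      exact: e5.
    by move=> j; apply: gl_pt_map.
  by have := phiL.2 0 0; rewrite !mul0r rmorph0 mul0r.
have Q0 : mmap j1 (gl_pt GW gW) Q = 0.
  rewrite QH big1 // => i _; rewrite -[RHS](mulr0 (j1 (a i))) -[in RHS](H0 i).
  by congr (_ * _); apply: eq_mmap => // x; apply: tens_liftl.
have j1r x : j1 (tr x) = jl (incl x) by exact: tens_liftr.
(* Because Psi_1 G = Psi_2, substituting G moves the evaluation from the left copy of Psi to the
   right one. *)
have evW w : ev' j1 GW gW w = jr (ev1' w).
  apply/esym; apply: rmorph_ev1' => [x|e||].
  - by apply/esym; apply: tens_liftl.
  - by rewrite j1r -[LHS]tens_base.
  - have -> : map_mx j1 (map_mx tr PsiL) = map_mx jl Psi.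
      by apply/matrixP => i j; rewrite !mxE j1r.
    by rewrite mulmxA -map_mxM mulmxV // map_mx1 mul1mx.
  by rewrite j1r mulrA -rmorphM /= mulVr ?rmorph1 ?mul1r.
(* With index 1 for [j1] and 2 for [jr], the vanishing of [Q] at G reads s_1 s_2 (z_2 - z_1) = 0,
   and both copies of s are units. *)
have jz : jr z = j1 z.
  have j1k : j1 (tr (ev1 k)) * j1 (tr c) = 1 by rewrite -!rmorphM kc !rmorph1.
  have jrk : jr (tr (ev1 k)) * jr (tr c) = 1 by rewrite -!rmorphM kc !rmorph1.
  have : j1 (tr (ev1 k)) * jr (tr (ev1 k)) * (jr z - j1 z) = 0.
    rewrite -[RHS]Q0 QE !evW ev1'r -kz !rmorphM /=; ring.
  move/(congr1 (fun x => j1 (tr c) * jr (tr c) * x)); rewrite mulr0 => e.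
  apply/eqP; rewrite -subr_eq0; apply/eqP; rewrite -[RHS]e.
  transitivity ((j1 (tr (ev1 k)) * j1 (tr c)) * (jr (tr (ev1 k)) * jr (tr c)) * (jr z - j1 z)).
    by rewrite j1k jrk !mul1r.
  by ring.
(* Contracting the factor L turns [jr z] into z and [j1 z] into an element of E'. *)
have [phi [phi1 phiD phiZ]] := exists_linear_form (st_EL T).
have phiL : linear_form (st_EL T) phi by split.
exists [seq (p.1, phi (incl p.2)) | p <- repr z].
apply: etrans (esym (contract_tensr iE phiL z phi1)) _.
rewrite jz {1}(tensor_sum z) rmorph_sum contract_sum //.
rewrite big_map; apply: eq_bigr => p _; rewrite rmorphM j1r.
by rewrite [j1 _]tens_liftl mulrC contractM //= tensM mulrC.
Qed.
End Fixed.

(** * The action of Gamma(F') on Lambda' *)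

Local Notation M := (tensor (st_EL T) (st_EL T)).
Local Notation il := (tensl (st_EL T) (st_EL T)).
Local Notation ir := (tensr (st_EL T) (st_EL T)).
Local Notation FL := (fun c => st_EL T (st_FE T c)).

Definition torsor_mx : 'M[M]_r := map_mx il (invmx Psi) *m map_mx ir Psi.
Definition torsor_inv : M := il (\det Psi) * ir (\det Psi)^-1.
Local Notation G := torsor_mx.
Local Notation g := torsor_inv.

Lemma torsor_mxE : map_mx il Psi *m G = map_mx ir Psi.
Proof. by rewrite mulmxA -map_mxM mulmxV // map_mx1 mul1mx. Qed.

(** Both copies of Psi are multiplied on the left by the same matrix, since Phi has entries in E; it
    cancels in Psi_1^-1 Psi_2. *)
Lemma sigma2_torsor_mx : map_mx (sigma2 T) G = G.
Proof.
have sl : map_mx (sigma2 T) (map_mx il Psi) = map_mx (il \o st_EL T) Phi *m map_mx il Psi.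
  transitivity (map_mx il (map_mx (st_sigma T) Psi)).
    by apply/matrixP => i j; rewrite !mxE sigma2l.
  by rewrite Psi_eq map_mxM; congr (_ *m _); apply/matrixP => i j; rewrite !mxE.
have sr : map_mx (sigma2 T) (map_mx ir Psi) = map_mx (il \o st_EL T) Phi *m map_mx ir Psi.
  transitivity (map_mx ir (map_mx (st_sigma T) Psi)).
    by apply/matrixP => i j; rewrite !mxE sigma2r.
  rewrite Psi_eq map_mxM; congr (_ *m _); apply/matrixP => i j; rewrite !mxE /=.
  by rewrite tens_base.
have lV : map_mx (sigma2 T) (map_mx il (invmx Psi)) *m map_mx (sigma2 T) (map_mx il Psi) = 1%:M.
  by rewrite -!map_mxM mulVmx // !map_mx1.
have := congr1 (mulmx (map_mx (sigma2 T) (map_mx il (invmx Psi))))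
  (congr1 (map_mx (sigma2 T)) torsor_mxE).
rewrite map_mxM mulmxA lV mul1mx => ->.
by rewrite sr -torsor_mxE mulmxA -sl mulmxA lV mul1mx.
Qed.

Lemma det_torsor : \det G * g = 1.
Proof.
have du : \det Psi \is a GRing.unit by rewrite -unitmxE.
rewrite det_mulmx !det_map_mx /g mulrACA -!rmorphM det_inv mulVr // mulrV //.
by rewrite !rmorph1 mulr1.
Qed.

Lemma sigma2_torsor_inv : sigma2 T g = g.
Proof.
have := congr1 (sigma2 T) det_torsor.
rewrite rmorphM rmorph1 -det_map_mx sigma2_torsor_mx => e.
by rewrite -[LHS]mul1r -det_torsor mulrAC e mul1r.
Qed.

(* If h(Psi) = 0, then h(Psi_1 G) = 0 in L (x)_E L.  As the entries of G are
   sigma-invariant, linear disjointness allows to specialize G to gamma. *)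
Lemma ev_kernel gamma h : Gamma_point Psi iF' gamma -> ev1 h = 0 -> evg gamma (pr h) = 0.
Proof.
move=> [gu gP] h0; rewrite evgr.
have [Q QE] := universal_polynomial Psi h.
have [m [a [H [QH _]]]] := mpoly_frame (F_Lambda Psi) Q.
pose gi i : M := mmap (fun c => il (FL c)) (gl_pt G g) (H i).
have gfix i : sigma2 T (gi i) = gi i.
  rewrite /gi rmorph_mmap; apply: eq_mmap => [c|k].
    by rewrite sigma2l; congr il; apply/st_fix_L; exists c.
  by rewrite gl_pt_map sigma2_torsor_mx sigma2_torsor_inv.
have rel : \sum_i il (incl (a i)) * gi i = 0.
  transitivity (ev (il \o incl) G g h).
    by rewrite -QE (QH _ (il \o incl)); apply: eq_bigr => i _.
  transitivity ((ir \o incl) (ev1 h)); last by rewrite /= h0 !rmorph0.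
  apply/esym/rmorph_ev1 => [e||] /=.
  - by rewrite -tens_base.
  - have incE (u : {rmorphism L -> M}) : map_mx (u \o incl) PsiL = map_mx u Psi.
      by apply/matrixP => i j; rewrite !mxE.
    by rewrite !incE torsor_mxE.
  - by rewrite mulrA -rmorphM mulVr ?rmorph1 ?mul1r.
have evE : ev tr (map_mx tl gamma) (tl (\det gamma)^-1) h =
    \sum_i tr (a i) * tl (gl_eval iF' gamma (\det gamma)^-1 (H i)).
  rewrite -QE QH; apply: eq_bigr => i _; congr (_ * _).
  rewrite [RHS]rmorph_mmap; apply: eq_mmap => [c|k]; first exact/esym/tens_base.
  by rewrite gl_pt_map.
(* Contracting F' to F by an arbitrary form [chi] leaves an identity in L whose scalars [nu i] lie
   in F. *)
rewrite evE; apply: contract_separates => chi chiL; apply: Lambda_incl_inj.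
rewrite rmorph0 contract_sum // rmorph_sum.
pose nu i := chi (gl_eval iF' gamma (\det gamma)^-1 (H i)).
transitivity (\sum_i incl (a i) * FL (nu i)).
  by apply: eq_bigr => i _; rewrite mulrC contractM // rmorphM mulrC.
apply: (linearly_disjoint gfix) => // la lag.
(* An F-linear relation between the values [gi] is a polynomial in q, so it vanishes at gamma as
   well. *)
have qH : Gamma_ideal Psi (\sum_i la i *: H i).
  rewrite /Gamma_ideal /gl_eval.
  pose ev : {rmorphism {mpoly (st_F T)[r * r + 1]} -> M} :=
    mmap (il \o (st_EL T \o st_FE T)) (gl_pt G g).
  rewrite -[LHS]/(ev _) rmorph_sum -[RHS]lag; apply: eq_bigr => i _.
  exact: mmapZ.
have := gP _ qH; rewrite /gl_eval (raddf_sum (mmap iF' _)) /=.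
under eq_bigr do rewrite mmapZ.
move/(congr1 chi); rewrite (linear_form_sum _ _ chiL).
have -> : chi 0 = 0 by have := chiL.2 0 0; rewrite !mul0r rmorph0 mul0r.
by move=> e; apply: etrans e; apply: eq_bigr => i _; rewrite chiL.2.
Qed.

(** Evaluation at Psi commutes with contraction of F', so each coefficient of [w] along a frame
    vanishes at Psi. *)
Lemma ev1'_kernel gamma w : Gamma_point Psi iF' gamma -> ev1' w = 0 -> evg gamma w = 0.
Proof.
move=> gP w0; have [m [d [phi [phiL wE]]]] := tens_frame w.
have h0 i : ev1 (contract (phi i) w) = 0.
  have evC k : ev1 (F_Pol T r k) = F_Lambda Psi k by exact: evC.
  rewrite -(contract_mapr evC w (phiL i)).
  suff -> : tens_mapr iF' evC w = ev1' w by rewrite w0 contract0.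
  apply: (tensor_rmorph_ext (u := tens_mapr iF' evC)) => [c|h].
    by rewrite tens_maprl ev1'l.
  by rewrite tens_maprr ev1'r.
rewrite wE; apply: etrans (rmorph_sum (evg gamma) _ _ _) _; apply: big1 => i _.
apply: etrans (rmorphM (evg gamma) _ _) _.
by have := ev_kernel gP (h0 i) => /= ->; rewrite mulr0.
Qed.

(** Exchanging the factors of L (x)_E L sends G to its inverse, so q is stable under X |-> X^-1. *)
Lemma Gamma_point_inv gamma : Gamma_point Psi iF' gamma -> Gamma_point Psi iF' (invmx gamma).
Proof.
move=> [gu gP]; split=> [|h qh]; first by rewrite unitmx_inv.
pose K := st_F T.
(* Inversion in polynomial form: X goes to Y adj X, and Y to det X. *)
pose inv : {rmorphism {mpoly K[r * r + 1]} -> {mpoly K[r * r + 1]}} :=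
  mmap (@mpolyC _ K) (gl_pt (gl_Y r K *: \adj (gl_X r K)) (\det (gl_X r K))).
have invE (C : comNzRingType) (c : {rmorphism K -> C}) (N : 'M[C]_r) y h' :
    mmap c (gl_pt N y) (inv h') = mmap c (gl_pt (y *: \adj N) (\det N)) h'.
  pose U : {rmorphism {mpoly K[r * r + 1]} -> C} := mmap c (gl_pt N y).
  rewrite [LHS](rmorph_mmap U); apply: eq_mmap => [x|k]; first exact: mmapC.
  rewrite gl_pt_map map_mxZ map_mx_adj -det_map_mx (mmap_gl_X c N y).
  by congr (gl_pt (_ *: _) _ _); apply: (mmap_gl_Y c N y).
have du : \det Psi \is a GRing.unit by rewrite -unitmxE.
have adjE (C : comNzRingType) (N N' : 'M[C]_r) y : \det N * y = 1 -> N' *m N = 1%:M ->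
    y *: \adj N = N'.
  move=> dy N'N; rewrite -[LHS]mul1mx -N'N -mulmxA -scalemxAr mul_mx_adj.
  by rewrite scale_scalar_mx mulrC dy mulmx1.
have := gP (inv h); rewrite /gl_eval (invE _ iF').
have gd : \det gamma \is a GRing.unit by rewrite -unitmxE.
rewrite (adjE _ _ (invmx gamma)) ?mulVmx ?mulrV // det_inv invrK; apply.
rewrite /Gamma_ideal /gl_eval.
rewrite [LHS](invE _ (il \o (st_EL T \o st_FE T)) G g).
have swap_il x : tens_swap (st_EL T) (st_EL T) (il x) = ir x by exact: tens_swapl.
have swap_ir x : tens_swap (st_EL T) (st_EL T) (ir x) = il x by exact: tens_swapr.
have := congr1 (tens_swap (st_EL T) (st_EL T)) qh; rewrite rmorph0 => <-.
rewrite /gl_eval rmorph_mmap; apply: eq_mmap => [c|k].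
  by rewrite swap_il -tens_base.
have swG : map_mx (tens_swap (st_EL T) (st_EL T)) G = map_mx ir (invmx Psi) *m map_mx il Psi.
  by rewrite map_mxM; congr (_ *m _); apply/matrixP => i j; rewrite !mxE ?swap_il ?swap_ir.
have VG : map_mx ir (invmx Psi) *m map_mx il Psi *m G = 1%:M.
  by rewrite -mulmxA torsor_mxE -map_mxM mulVmx // map_mx1.
rewrite gl_pt_map swG (adjE _ _ _ _ det_torsor VG).
by rewrite rmorphM swap_il swap_ir det_mulmx !det_map_mx det_inv mulrC.
Qed.

(* Gamma-translates of a fraction denominator are invertible: they are regular
   because translation by gamma^-1 undoes translation by gamma, and regular
   elements of Lambda' are invertible as Lambda' is integral over Lambda. *)
Lemma evg_unit (F'_alg : forall x : F', algebraicOver iF' x) gamma k c :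
  Gamma_point Psi iF' gamma -> ev1 k * c = 1 -> exists c', evg gamma (pr k) * c' = 1.
Proof.
move=> gP kc; have gVP := Gamma_point_inv gP.
have gu : gamma \in unitmx := gP.1.
have tauE delta w : ev1' (translate iF' delta w) = evg delta w.
  apply: etrans (ev'_translate _ _ _ _ _) _.
  by rewrite mul1mx mul1r map_mx_id.
have cancel delta w : delta \in unitmx -> evg (invmx delta) (translate iF' delta w) = ev1' w.
  move=> du; apply: etrans (ev'_translate _ _ _ _ _) _.
  have -> : map_mx tl (invmx delta) *m map_mx idfun (map_mx tl delta) = 1%:M.
    by rewrite map_mx_id // -map_mxM mulVmx // map_mx1.
  have -> : tl (\det (invmx delta))^-1 * idfun (tl (\det delta)^-1) = 1.
    by rewrite -rmorphM det_inv invrK mulrV -?unitmxE // rmorph1.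
  by [].
apply: (Lambda'_regular_unit Psi_unit Psi_eq F'_alg) => t kt.
have [k' [h [c' [k't k'c']]]] := Lambda'_fraction t.
(* Let t = h(Psi) / k'(Psi) be killed by k(Psi gamma). Translating by gamma^-1 gives h(Psi gamma^-1)
   k(Psi) = 0, where k(Psi) is a unit; translating h(Psi gamma^-1) = 0 back by gamma gives h(Psi) =
   0. *)
have e1 : ev1' (h * translate iF' gamma (pr k)) = 0.
  apply: etrans (rmorphM ev1' _ _) _; rewrite tauE -k't.
  by rewrite -mulrA [t * _]mulrC kt mulr0.
have e2 : evg (invmx gamma) h * ev1' (pr k) = 0.
  rewrite -(cancel gamma _ gu); apply: etrans (esym (rmorphM (evg (invmx gamma)) _ _)) _.
  exact: ev1'_kernel.
have e3 : evg (invmx gamma) h = 0.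
  have := congr1 (fun x => x * tr c) e2; rewrite mul0r -mulrA ev1'r -rmorphM kc.
  by rewrite rmorph1 mulr1.
have e4 : ev1' (translate iF' (invmx gamma) h) = 0 by rewrite tauE.
have := ev1'_kernel gP e4; have := cancel (invmx gamma) h; rewrite invmxK unitmx_inv => -> //.
rewrite -k't => e5; have := congr1 (fun x => tr c' * x) e5; rewrite mulr0 mulrA -rmorphM.
by rewrite [c' * _]mulrC k'c' rmorph1 mul1r.
Qed.

(** Substituting Psi gamma respects the relations of Psi and makes the denominators invertible, so
    it extends to fractions. *)
Lemma exists_extends_action (F'_alg : forall x : F', algebraicOver iF' x) gamma :
  Gamma_point Psi iF' gamma -> exists alpha, extends_action (Psi := Psi) (iF' := iF') gamma alpha.
Proof.
move=> gP.
have [w h0|x|alpha alphaE] := extend_to_fractions (u := ev1') (v := evg gamma).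
- exact: ev1'_kernel.
- have [k [h [c [kx kc]]]] := Lambda'_fraction x.
  have [c' kc'] := evg_unit F'_alg gP kc.
  by exists (pr k), h, c'; rewrite ev1'r.
exists alpha; split=> [a e|Psi'].
  have teE : tens iF' (F_Lambda Psi) a (cst e) = ev1' (pl a * pr e%:MP).
    rewrite tensM; apply: esym; apply: etrans (rmorphM ev1' _ _) _.
    by rewrite ev1'l ev1'r evC.
  rewrite teE alphaE -teE tensM; apply: etrans (rmorphM (evg gamma) _ _) _.
  by rewrite ev'l evgr evC.
have XE i j : tr (PsiL i j) = ev1' (pr (gl_X r E i j)).
  rewrite ev1'r; have := ev_X (idfun : {rmorphism La -> La}) 1%:M 1.
  by move/matrixP/(_ i j); rewrite mulmx1 map_mx_id // mxE => ->.
apply/matrixP => i j; rewrite ![in LHS]mxE -/(PsiL i j).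
have := ev_X tr (map_mx tl gamma) (tl (\det gamma)^-1).
move/matrixP/(_ i j); rewrite mxE -evgr => <-.
rewrite -alphaE -XE; congr (alpha (tr _)); apply: val_inj.
by rewrite !mxE.
Qed.

Lemma in_E'_fixed (F'_alg : forall x : F', algebraicOver iF' x) (z : La') :
  in_E' z -> Gamma_fixed z.
Proof.
move=> [s ->] gamma gP; have [alpha ext] := exists_extends_action F'_alg gP.
exists alpha => //; rewrite rmorph_sum; apply: eq_bigr => p _; exact: ext.1.
Qed.
End Galois.

Theorem theorem4p20 (T : sigma_triple) (r : nat)
  (Phi : 'M[st_E T]_r) (Psi : 'M[st_L T]_r)
  (Phi_unit : Phi \in unitmx) (Psi_unit : Psi \in unitmx)
  (Psi_eq : map_mx (st_sigma T) Psi = map_mx (st_EL T) Phi *m Psi)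
  (F' : fieldType) (iF' : {rmorphism st_F T -> F'})
  (F'_alg : forall x : F', algebraicOver iF' x)
  (F'_dense : Gamma_dense Psi iF')
  (F'_cond : (forall x : F', exists c, x = iF' c) \/
             (forall l, regular_extension (F_Lambda_l Psi l))) :
  (forall z : Lambda' Psi iF', Gamma_fixed z <-> in_E' z) /\
  (forall z : Lambda' Psi iF',
     (exists x : Lambda_ring Psi, z = tensr iF' (F_Lambda Psi) x) /\
     Gamma_fixed z <->
     (exists e : st_E T,
        z = tensr iF' (F_Lambda Psi) (LambdaC (st_EL T) Psi e))).
Proof.
have red := Lambda'_reduced Psi_unit Psi_eq F'_cond.
have fixE z : Gamma_fixed z <-> in_E' (Psi := Psi) (iF' := iF') z.
  split; first exact: (Gamma_fixed_E' Psi_unit Psi_eq red F'_dense).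
  exact: (in_E'_fixed Psi_unit Psi_eq F'_alg).
split=> // z; split=> [[[x ->] /fixE[s sE]]|[e ->]]; last first.
  split; first by exists (LambdaC (st_EL T) Psi e).
  by apply/fixE; exists [:: (1, e)]; rewrite big_seq1.
(* A form F' -> F with value 1 at 1 retracts Lambda' onto Lambda and maps E' into E. *)
have [chi chiL chi1] := exists_form_at iF' (oner_neq0 F').
exists (\sum_(p <- s) st_FE T (chi p.1) * p.2); congr (tensr _ _ _).
rewrite -(contract_tensr (F_Lambda Psi) chiL x chi1) sE contract_sum // rmorph_sum.
by apply: eq_bigr => p _; rewrite tensM contractM // rmorphM.
Qed.
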